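(* Let $K$ be a field, $S=K[x_1,\dots,x_n]$, and let $I\subset S$ be a matroidal ideal in at most four variables (i.e. at most four variables occur in the minimal monomial generators of $I$). Then $\mathrm{reg}\,I^{(k)}=\mathrm{reg}\,I^k$ and $I^{(k)}$ has linear quotients, for all $k\ge1$.
   Context: $S$ is standard graded; $\mathrm{reg}$ is Castelnuovo–Mumford regularity. The $k$th symbolic power is $I^{(k)}=\bigcap_{P\in\mathrm{Ass}(I)}(I^kS_P\cap S)$, with $\mathrm{Ass}(I)=\mathrm{Ass}(S/I)$. Let $\mathcal{G}(I)$ be the minimal monomial generating set of a monomial ideal $I$ and $\deg_{x_i}(u)$ the exponent of $x_i$ in a monomial $u$. A nonzero monomial ideal $I$ is *polymatroidal* if it is generated in a single degree and for all $u,v\in\mathcal{G}(I)$ and every $i$ with $\deg_{x_i}(u)>\deg_{x_i}(v)$ there is $j$ with $\deg_{x_j}(u)<\deg_{x_j}(v)$ and $x_j(u/x_i)\in\mathcal{G}(I)$. It is *matroidal* if it is polymatroidal and generated by squarefree monomials. A monomial ideal $L$ has linear quotients if its minimal monomial generators can be ordered $u_1,\dots,u_s$ so that $(u_1,\dots,u_{i-1}):(u_i)$ is generated by variables for $i=2,\dots,s$. *)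

(* Defs.v *)
From HB Require Import structures.
From mathcomp Require Import all_boot all_order all_algebra.
From mathcomp Require Import mpoly.

Set Implicit Arguments.
Unset Strict Implicit.
Unset Printing Implicit Defensive.

Import GRing.Theory.
Local Open Scope ring_scope.

(** Ideals are Prop-valued predicates, since membership in an arbitrary ideal,
    colon ideal or contraction from a localization is not boolean. *)

Section CommutativeAlgebra.
Variable R : comNzRingType.
Implicit Types (I J P : R -> Prop).

(* Finite A-linear combinations of elements of G, for a subring A of R. *)
Definition span_over (A G : R -> Prop) (x : R) : Prop :=
  exists (m : nat) (a g : 'I_m -> R),
    [/\ forall i, A (a i), forall i, G (g i) & x = \sum_(i < m) a i * g i].

Definition ideal_gen (G : R -> Prop) : R -> Prop := span_over (fun=> True) G.

Definition is_ideal I : Prop :=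
  [/\ I 0, forall x y, I x -> I y -> I (x + y) & forall a x, I x -> I (a * x)].

Definition is_prime_ideal P : Prop :=
  [/\ is_ideal P, ~ P 1 & forall x y, P (x * y) -> P x \/ P y].

Definition ideal_pow I (k : nat) : R -> Prop :=
  ideal_gen (fun x => exists2 t : 'I_k -> R,
    forall i, I (t i) & x = \prod_(i < k) t i).

Definition colon I J (x : R) : Prop := forall y, J y -> I (x * y).

(* P is in Ass(R/I): a prime that is the annihilator of the class of some f. *)
Definition associated_prime I P : Prop :=
  is_prime_ideal P /\ exists f, forall x, P x <-> I (x * f).

End CommutativeAlgebra.

Section Localization.
Variable R : idomainType.
Implicit Types (I J P : R -> Prop).

Definition loc_ring P (z : {fraction R}) : Prop :=
  exists a s : R, ~ P s /\ z = tofrac a / tofrac s.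

Definition loc_ideal P J : {fraction R} -> Prop :=
  span_over (loc_ring P) (fun z => exists2 g, J g & z = tofrac g).

Definition symb_pow I (k : nat) (f : R) : Prop :=
  forall P, associated_prime I P -> loc_ideal P (ideal_pow I k) (tofrac f).

End Localization.

Section MonomialIdeals.
Variables (K : fieldType) (n : nat).
Local Notation S := {mpoly K[n]}.
Implicit Types (I L : S -> Prop) (u v m : 'X_{1..n}).

Definition monomial_gen (M : 'X_{1..n} -> Prop) : S -> Prop :=
  ideal_gen (fun g => exists2 m, M m & g = 'X_[m]).

Definition monomial_ideal I : Prop :=
  exists M : 'X_{1..n} -> Prop, forall f, I f <-> monomial_gen M f.

Definition mingens I u : Prop :=
  I 'X_[u] /\ forall v, I 'X_[v] -> (v <= u)%MM -> v = u.

Definition polymatroidal I : Prop :=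
  [/\ monomial_ideal I,
      exists2 f, I f & f != 0,
      exists d : nat, forall u, mingens I u -> mdeg u = d
    & forall u v, mingens I u -> mingens I v ->
      forall i : 'I_n, (v i < u i)%N ->
      exists2 j : 'I_n, (u j < v j)%N & mingens I (u - U_(i) + U_(j))%MM].

Definition matroidal I : Prop :=
  polymatroidal I /\ forall u, mingens I u -> forall i, (u i <= 1)%N.

Definition at_most_variables (c : nat) I : Prop :=
  exists2 V : {set 'I_n}, (#|V| <= c)%N &
    forall u, mingens I u -> forall i, (0 < u i)%N -> i \in V.

Definition linear_quotients L : Prop :=
  monomial_ideal L /\
  exists us : seq 'X_{1..n},
    [/\ uniq us, forall u, u \in us <-> mingens L u
      & forall i, (0 < i < size us)%N ->
        exists V : {set 'I_n}, forall f,
          colon (monomial_gen (fun u => u \in take i us))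
                (monomial_gen (fun u => u = nth 0%MM us i)) f
          <-> ideal_gen (fun g => exists2 j, j \in V & g = 'X_j) f].

End MonomialIdeals.

Section Regularity.
Variables (K : fieldType) (n : nat).
Local Notation S := {mpoly K[n]}.
Implicit Types I : S -> Prop.

(** Minimal graded free resolutions
      ... -> F_2 -> F_1 -> F_0 -> I -> 0
    of a graded ideal I of S.  The module F_i is the free module of rows
    'rV[S]_(rank i), whose p-th basis vector sits in degree shift i p, i.e.
    F_i = \bigoplus_p S(- shift i p); maps act by right multiplication.
    Natural shifts lose nothing here: I lives in degrees >= 0, hence so do the
    basis elements of a minimal resolution. *)
Record min_graded_res I := MinGradedRes {
  rank : nat -> nat;
  shift : forall i, 'I_(rank i) -> nat;
  diff : forall i, 'M[S]_(rank i.+1, rank i);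
  augm : 'cV[S]_(rank 0);
  augm_homog : forall p, augm p 0 \is (shift p).-homog;
  diff_homog : forall i p q, diff i p q != 0 ->
    exists2 e, shift p = (shift q + e)%N & diff i p q \is e.-homog;
  augm_onto : forall f, I f <-> exists v : 'rV[S]_(rank 0), v *m augm = f%:M;
  exact0 : forall v : 'rV[S]_(rank 0),
    v *m augm = 0 <-> exists w, v = w *m diff 0;
  exactS : forall i (v : 'rV[S]_(rank i.+1)),
    v *m diff i = 0 <-> exists w, v = w *m diff i.+1;
  (* the image of each differential lies in (x_1, ..., x_n) F_i *)
  diff_minimal : forall i p q, (diff i p q)@_0%MM = 0
}.

(* reg I = r, where reg I is the maximum of j - i over the nonzero graded Betti
   numbers beta_{i,j}(I), i.e. over the pairs (i, j) such that S(-j) is a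
   summand of F_i in the minimal graded free resolution, which is unique up to
   isomorphism.  A relation, so that reg has no junk value. *)
Definition has_reg I (r : int) : Prop :=
  exists F : min_graded_res I,
    (forall i (p : 'I_(rank F i)), (shift p)%:Z - i%:Z <= r) /\
    (exists i (p : 'I_(rank F i)), (shift p)%:Z - i%:Z = r).

End Regularity.

(* Main.v *)
Require Import Defs.
From Stdlib Require Import Classical ClassicalEpsilon.
From mathcomp Require Import all_boot all_order all_algebra.
From mathcomp Require Import mpoly zify ring.

(** Powers. I^k and I^(k) are monomial ideals: the exponents of I^k are
    those above a sum of k bases, and an exponent u lies in I^(k) iff
    u(A) >= k for every set A of variables meeting all bases. Indeed the
    associated primes of I are the (x_i, i in A) with A minimal such, and after
    inverting the variables outside A the ideal I becomes (x_i, i in A).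

    Linear quotients. For a degree-compatible order on the generators they follow
    from an exchange property: if v precedes u, then some x_j with v_j > u_j is
    such that u x_j is divisible by an element of the ideal preceding u.

    Regularity. If rows g_1, ..., g_s of a graded free module, of nondecreasing
    degrees, have colon ideals (g_1, ..., g_(p-1)) : g_p = (x_v, v in V_p), then
    their syzygies are generated by the x_v e_p - (combination of earlier e_q),
    whose colon ideals in the order by (p, v) are (x_w, w in V_p, w < v), and
    whose degrees grow by exactly one. Iterating gives a minimal resolution, so
    the regularity is the largest degree of a generator. For both powers it is
    k times the rank.

    Matroids on four elements. Variables of a parallel class enter the exponents
    of both powers only through their sum. Up to loops and parallel classes there
    remain U_(m,m), U_(2,3) with or without a coloop, U_(2,4) and U_(3,4), for
    which the exponents are described by linear inequalities in four integers. *)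

Set Implicit Arguments.
Unset Strict Implicit.
Unset Printing Implicit Defensive.

Import Order.TTheory GRing.Theory.
Local Open Scope ring_scope.

(** * Syzygies of families with linear quotients *)

Section Supports.
Variables (K : fieldType) (n : nat).
Local Notation S := {mpoly K[n]}.
Implicit Types (P Q : 'X_{1..n} -> Prop) (f g : S) (V : {set 'I_n}).

(** The obstacle is that symbolic powers have minimal generators of several degrees: for U_(2,3) and
    k = 2 the product of the three variables appears beside the generators of degree four. The
    regularity is therefore known only once a degree-compatible order with linear quotients is
    found. The two regularities agree because, for a basis b of rank r, the exponent k b is a
    minimal generator of both powers, and no minimal generator of either has degree above r k. The
    linear inequalities come from flats. By Edmonds' base packing theorem, y dominates a sum of k
    bases iff y(E - F) >= k (r - r(F)) for every flat F. The minimal blocking sets are the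
    complements of hyperplanes, so the symbolic power keeps only the inequalities with F a
    hyperplane. The development checks these descriptions directly for each model. Throughout, a
    monomial ideal is represented as [supp_in J] with [J] closed upwards, so that membership is a
    termwise condition on exponents. *)

Definition supp_in P f : Prop := forall m, m \in msupp f -> P m.

Lemma supp_inW P Q f : (forall m, P m -> Q m) -> supp_in P f -> supp_in Q f.
Proof. by move=> PQ Pf m /Pf/PQ. Qed.

Lemma supp_in0 P : supp_in P 0.
Proof. by move=> m; rewrite msupp0. Qed.

Lemma supp_inD P f g : supp_in P f -> supp_in P g -> supp_in P (f + g).
Proof.
by move=> Pf Pg m /msuppD_le; rewrite mem_cat => /orP[/Pf|/Pg].
Qed.

Lemma supp_inN P f : supp_in P f -> supp_in P (- f).
Proof. by move=> Pf m; rewrite (perm_mem (msuppN f)) => /Pf. Qed.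

Lemma supp_in_sum (I : Type) (r : seq I) (C : pred I) (F : I -> S) P :
  (forall i, C i -> supp_in P (F i)) -> supp_in P (\sum_(i <- r | C i) F i).
Proof.
move=> PF; elim/big_rec: _ => [|i f Ci Pf]; first exact: supp_in0.
by apply: supp_inD Pf; apply: PF.
Qed.

Lemma supp_inM P Q (T : 'X_{1..n} -> Prop) f g :
  (forall a b, P a -> Q b -> T (a + b)%MM) ->
  supp_in P f -> supp_in Q g -> supp_in T (f * g).
Proof.
move=> PQ Pf Qg m /msuppM_le/allpairsP[[a b]] /= [/Pf Pa /Qg Qb ->].
exact: PQ.
Qed.

Lemma supp_inX P m : supp_in P 'X_[m] <-> P m.
Proof.
split=> [H | Pm m']; first by apply: H; rewrite msuppX inE.
by rewrite msuppX inE => /eqP ->.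
Qed.

Lemma supp_inZ P c f : supp_in P f -> supp_in P (c *: f).
Proof. by move=> Pf m /msuppZ_le/Pf. Qed.

Lemma mem_msuppMX f u m : m \in msupp f -> (m + u)%MM \in msupp (f * 'X_[u]).
Proof.
move=> mf; rewrite (perm_mem (msuppMX _ _)) addmC.
by apply/mapP; exists m.
Qed.

Lemma supp_inMX P f u :
  supp_in P (f * 'X_[u]) <-> supp_in (fun m => P (m + u)%MM) f.
Proof.
split=> H m; first by move/(mem_msuppMX u); apply: H.
by rewrite (perm_mem (msuppMX _ _)) => /mapP[m' /H Pm ->]; rewrite addmC.
Qed.

(** The degree condition on the coefficient, at a basis vector of degree [b], of an element of
    degree [E]. The additive form forces this coefficient to vanish when E < b, where a truncated
    difference would admit constants. *)
Definition shifted_homog (b E : nat) f : Prop :=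
  supp_in (fun m => mdeg m + b = E)%N f.

(** The monomials of the prime ideal (x_v, v in V). *)
Definition hits V (m : 'X_{1..n}) : Prop := exists2 v, v \in V & (0 < m v)%N.

(** Each term of [f] is charged to one variable of [V] dividing it, which respects every grading at
    once. *)
Lemma hits_decomp V f : supp_in (hits V) f ->
  exists2 a : 'I_n -> S, f = \sum_(v in V) a v * 'X_v &
    forall b E, shifted_homog b E f -> forall v, shifted_homog b.+1 E (a v).
Proof.
move=> fV; suff [a fE aH] : exists2 a : 'I_n -> S,
    f = \sum_(v in V) a v * 'X_v &
    forall b E, (forall m, m \in msupp f -> mdeg m + b = E)%N ->
      forall v, shifted_homog b.+1 E (a v) by exists a.
rewrite {1}(mpolyE f); move: fV; rewrite /supp_in.
elim: (msupp f) => [|m s IHs] sV.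
  exists (fun=> 0) => [|b E _ v]; last exact: supp_in0.
  by rewrite big_nil big1 // => v _; rewrite mul0r.
have [|a sE aH] := IHs; first by move=> m' m's; apply: sV; rewrite inE m's orbT.
have [v vV mv] := sV m (mem_head _ _).
exists (fun w => (if w == v then f@_m *: 'X_[m - U_(v)] else 0) + a w).
  rewrite big_cons sE.
  under [RHS]eq_bigr do rewrite mulrDl.
  rewrite big_split /=; congr (_ + _).
  rewrite (bigD1 v) //= eqxx big1 ?addr0 => [|w /andP[_ /negbTE->]]; last first.
    by rewrite mul0r.
  by rewrite -scalerAl -mpolyXD submK // lep1mP -lt0n.
move=> b E bE w; apply: supp_inD; last first.
  by apply: aH => m' m's; apply: bE; rewrite inE m's orbT.
case: eqP => _; last exact: supp_in0.
apply: supp_inZ; apply/supp_inX.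
rewrite -(bE m (mem_head _ _)).
rewrite -{2}(@submK _ U_(v)%MM m) ?lep1mP -?lt0n // mdegD mdeg1; lia.
Qed.

End Supports.

Section Stages.
Variables (K : fieldType) (n : nat).
Local Notation S := {mpoly K[n]}.

(* A finite ordered family of homogeneous elements (the rows of [sg], ordered
   by [sh]) of a graded free module, of nondecreasing degrees [sb], such that
   the colon ideal of the preceding rows by row [p] is generated by the
   variables in [sV p]. *)
Record stage := Stage {
  sr : nat; ss : nat;
  sa : 'I_sr -> nat; sb : 'I_ss -> nat;
  sg : 'M[S]_(ss, sr);
  sh : 'I_ss -> nat;
  sV : 'I_ss -> {set 'I_n};
  sh_inj : injective sh;
  sb_mono : forall p q, (sh p < sh q)%N -> (sb p <= sb q)%N;
  sg_homog : forall p t, shifted_homog (sa t) (sb p) (sg p t);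
  sg_lift : forall p v, v \in sV p -> exists c : 'rV[S]_ss,
    [/\ forall q, (sh p <= sh q)%N -> c 0 q = 0,
        forall q, shifted_homog (sb q) (sb p).+1 (c 0 q)
      & 'X_v *: row p sg = c *m sg];
  sg_colon : forall p f (c : 'rV[S]_ss),
    (forall q, (sh p <= sh q)%N -> c 0 q = 0) -> f *: row p sg = c *m sg ->
    supp_in (hits (sV p)) f
}.

Section Syzygies.
Variable X : stage.

Definition lift_coef p v : 'rV[S]_(ss X) :=
  epsilon (inhabits 0) (fun c : 'rV[S]_(ss X) => [/\ forall q, (sh p <= sh q)%N -> c 0 q = 0,
    forall q, shifted_homog (sb q) (sb p).+1 (c 0 q)
    & 'X_v *: row p (sg X) = c *m sg X]).

Lemma lift_coefP (p : 'I_(ss X)) v : v \in sV p ->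
  [/\ forall q, (sh p <= sh q)%N -> lift_coef p v 0 q = 0,
      forall q, shifted_homog (sb q) (sb p).+1 (lift_coef p v 0 q)
    & 'X_v *: row p (sg X) = lift_coef p v *m sg X].
Proof. by move=> vp; rewrite /lift_coef; apply: epsilon_spec (sg_lift vp). Qed.

Definition syz (x : 'I_(ss X) * 'I_n) : 'rV[S]_(ss X) :=
  'X_(x.2) *: delta_mx 0 x.1 - lift_coef x.1 x.2.

Definition syz_index := {x : 'I_(ss X) * 'I_n | x.2 \in sV x.1}.
Definition syz_rank := #|{: syz_index}|.
Definition syz_at (x : 'I_syz_rank) : 'I_(ss X) * 'I_n :=
  val (enum_val x : syz_index).

Lemma syz_atP x : (syz_at x).2 \in sV (syz_at x).1.
Proof. exact: (valP (enum_val x : syz_index)). Qed.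

Lemma syz_at_inj : injective syz_at.
Proof. by move=> x y /val_inj/enum_val_inj. Qed.

Lemma syz_at_surj p v : v \in sV p -> exists x, syz_at x = (p, v).
Proof.
move=> vp; pose z : syz_index := Sub (p, v) vp.
by exists (enum_rank z); rewrite /syz_at enum_rankK.
Qed.

Definition syz_mx : 'M[S]_(syz_rank, ss X) := \matrix_x syz (syz_at x).
Definition syz_deg (x : 'I_syz_rank) : nat := (sb (syz_at x).1).+1.
(** Base-[n] encoding of the lexicographic order on pairs (p, v), as variable indices lie below
    [n]. *)
Definition syz_ht (x : 'I_syz_rank) : nat := sh (syz_at x).1 * n + (syz_at x).2.
Definition syz_vars (x : 'I_syz_rank) : {set 'I_n} :=
  [set v in sV (syz_at x).1 | (v < (syz_at x).2)%N].

Lemma syz_ht_lt x y : (syz_ht x < syz_ht y)%N =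
  (sh (syz_at x).1 < sh (syz_at y).1)%N ||
  (sh (syz_at x).1 == sh (syz_at y).1) && ((syz_at x).2 < (syz_at y).2)%N.
Proof.
rewrite /syz_ht; case: (syz_at x) (syz_at y) => [p v] [q w] /=.
move: (ltn_ord v) (ltn_ord w); case: ltngtP => [lt|lt|->] /= *; nia.
Qed.

(** Triangularity: the chosen lift involves only rows before [p], so the last nonzero entry of the
    syzygy is the variable x_v at [p]. *)
Lemma syzE p v q : v \in sV p -> (sh p <= sh q)%N ->
  syz (p, v) 0 q = (q == p)%:R * 'X_v.
Proof.
move=> /lift_coefP[c0 _ _] pq; rewrite !mxE eqxx /= c0 // subr0 mulrC.
by rewrite mulr_natl.
Qed.

Lemma syz_mul p v : v \in sV p -> syz (p, v) *m sg X = 0.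
Proof.
move=> /lift_coefP[_ _ cE].
by rewrite mulmxBl -scalemxAl -rowE cE subrr.
Qed.

Lemma syz_mx_mul : syz_mx *m sg X = 0.
Proof.
apply/row_matrixP=> x; rewrite row_mul rowK row0.
by case: (syz_at x) (syz_atP x) => p v /= /syz_mul.
Qed.

Lemma syz_homog p v q : v \in sV p ->
  shifted_homog (sb q) (sb p).+1 (syz (p, v) 0 q).
Proof.
move=> /lift_coefP[_ cH _]; rewrite !mxE eqxx /=.
apply: supp_inD; last by apply: supp_inN; apply: cH.
case: eqP => [->|_]; last by rewrite mulr0; apply: supp_in0.
by rewrite mulr1; apply/supp_inX; rewrite mdeg1.
Qed.

Lemma sum_syz_at p (F : 'I_(ss X) * 'I_n -> S) :
  \sum_(x | (syz_at x).1 == p) F (syz_at x) = \sum_(v in sV p) F (p, v).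
Proof.
pose A := [set x | (syz_at x).1 == p].
have injA : {in A &, injective (fun x => (syz_at x).2)}.
  move=> x y; rewrite !inE => /eqP xp /eqP yp xy; apply: syz_at_inj.
  by rewrite [LHS]surjective_pairing [RHS]surjective_pairing xp yp xy.
have -> : sV p = [set (syz_at x).2 | x in A].
  apply/setP=> v; apply/idP/imsetP=> [/syz_at_surj[x xE] | [x]].
    by exists x; rewrite ?inE xE.
  by rewrite inE => /eqP <- ->; apply: syz_atP.
rewrite big_imset //=; apply: eq_big => x; first by rewrite inE.
by move=> /eqP <-; rewrite -surjective_pairing.
Qed.

(* Induction on the highest row occurring in the syzygy [w]: its coefficient
   lies in the colon ideal, hence is removed by subtracting multiples of the
   [syz (p, v)]. *)
Lemma syz_gen N (w : 'rV[S]_(ss X)) :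
  (forall q, (N <= sh q)%N -> w 0 q = 0) -> w *m sg X = 0 ->
  exists c : 'rV[S]_syz_rank, [/\ w = c *m syz_mx,
    forall x, (N <= sh (syz_at x).1)%N -> c 0 x = 0
    & forall E, (forall q, shifted_homog (sb q) E (w 0 q)) ->
        forall x, shifted_homog (syz_deg x) E (c 0 x)].
Proof.
elim: N w => [|N IHN] w wN w0.
  exists 0; split=> [|x _|E _ x]; rewrite ?mxE //; last exact: supp_in0.
  by rewrite mul0mx; apply/rowP=> q; rewrite wN // mxE.
have [p /eqP pN | noN] := pickP [pred p | sh (s:=X) p == N]; last first.
  have [|//|c [-> cN cH]] := IHN w.
    move=> q; rewrite leq_eqVlt => /orP[/eqP Nq | /wN //].
    by have := noN q; rewrite /= Nq eqxx.
  by exists c; split=> // x Nx; apply: cN; apply: ltnW.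
have pV : supp_in (hits (sV p)) (w 0 p).
  apply: (@sg_colon X p (w 0 p) (\row_q if q == p then 0 else - w 0 q)).
    move=> q; rewrite mxE pN; case: eqP => // /eqP qp Nq; rewrite wN ?oppr0 //.
    rewrite ltn_neqAle Nq andbT; apply: contra qp => /eqP Nq'.
    by apply/eqP/sh_inj; rewrite pN.
  apply/rowP=> t; move/rowP/(_ t): w0; rewrite !mxE (bigD1 p) //= => /eqP.
  rewrite addr_eq0 => /eqP ->; rewrite [RHS](bigD1 p) //= mxE eqxx mul0r add0r.
  rewrite -sumrN; apply: eq_bigr => q qp.
  by rewrite !mxE (negbTE qp) mulNr.
have [a wpE aH] := hits_decomp pV.
pose c1 : 'rV[S]_syz_rank :=
  \row_x (if (syz_at x).1 == p then a (syz_at x).2 else 0).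
have c1E q : (c1 *m syz_mx) 0 q = \sum_(v in sV p) a v * syz (p, v) 0 q.
  rewrite mxE -(sum_syz_at p (fun x => a x.2 * syz x 0 q)).
  by rewrite [RHS]big_mkcond; apply: eq_bigr => x _; rewrite !mxE; case: eqP;
    rewrite ?mul0r.
have [||c [w1E cN cH]] := IHN (w - c1 *m syz_mx).
- move=> q Nq; rewrite mxE [X in _ + X]mxE c1E.
  under eq_bigr => v vp do rewrite syzE ?pN //.
  case: eqP => [->|/eqP qp].
    by under eq_bigr do rewrite mul1r; rewrite wpE subrr.
  rewrite big1 ?subr0 => [|v _]; last by rewrite mul0r mulr0.
  rewrite wN // ltn_neqAle Nq andbT; apply: contra qp => /eqP Nq'.
  by apply/eqP/sh_inj; rewrite pN.
- by rewrite mulmxBl -mulmxA syz_mx_mul mulmx0 w0 subrr.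
exists (c + c1); split=> [|x Nx|E wH x].
- by rewrite mulmxDl -w1E subrK.
- rewrite !mxE cN ?(ltnW Nx) // add0r; case: eqP => // xp.
  by move: Nx; rewrite xp pN ltnn.
have c1H : shifted_homog (syz_deg x) E (c1 0 x).
  rewrite mxE; case: eqP => [xp|_]; last exact: supp_in0.
  by rewrite /syz_deg xp; apply: aH; apply: wH.
rewrite mxE; apply: supp_inD c1H; apply: cH => q.
rewrite mxE [X in _ + X]mxE; apply: (supp_inD (wH q)); apply: supp_inN.
rewrite c1E; apply: supp_in_sum => v vp.
apply: supp_inM (aH _ _ (wH p) v) (syz_homog (q := q) vp) => m1 m2 <-.
by rewrite mdegD => H; lia.
Qed.

Lemma syz_exact (w : 'rV[S]_(ss X)) :
  w *m sg X = 0 <-> exists c, w = c *m syz_mx.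
Proof.
split=> [w0 | [c ->]]; last by rewrite -mulmxA syz_mx_mul mulmx0.
have [|c [-> _ _]] := @syz_gen (\max_q sh (s:=X) q).+1 w _ w0; last by exists c.
by move=> q; rewrite ltnNge leq_bigmax.
Qed.

Lemma syz_ht_inj : injective syz_ht.
Proof.
move=> x y xy; apply: syz_at_inj.
have := syz_ht_lt x y; have := syz_ht_lt y x; rewrite xy ltnn.
case: (syz_at x) (syz_at y) => [p v] [q w] /=.
case: ltngtP => //= /sh_inj ->; case: ltngtP => //= /val_inj -> //.
Qed.

Lemma syz_deg_mono x y : (syz_ht x < syz_ht y)%N -> (syz_deg x <= syz_deg y)%N.
Proof.
rewrite syz_ht_lt ltnS => /orP[/sb_mono // | /andP[/eqP/sh_inj -> _]] //.
Qed.

Lemma syz_mx_homog x q : shifted_homog (sb q) (syz_deg x) (syz_mx x q).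
Proof.
rewrite mxE /syz_deg; case: (syz_at x) (syz_atP x) => p v.
exact: syz_homog.
Qed.

(** In x_v syz(p, u) - x_u syz(p, v) the entries at [p] cancel, so it is a syzygy of the rows before
    [p]; [syz_gen] expresses it through syzygies of smaller height. Hence x_v syz(p, u) is x_u
    syz(p, v) plus such terms, all earlier since v < u. *)
Lemma syz_lift x v : v \in syz_vars x -> exists c : 'rV[S]_syz_rank,
  [/\ forall y, (syz_ht x <= syz_ht y)%N -> c 0 y = 0,
      forall y, shifted_homog (syz_deg y) (syz_deg x).+1 (c 0 y)
    & 'X_v *: row x syz_mx = c *m syz_mx].
Proof.
rewrite inE => /andP[vp vx]; have := syz_atP x.
case xE: (syz_at x) vp vx => [p u] /= vp vu up.
have [y yE] := syz_at_surj vp.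
pose w := 'X_v *: syz (p, u) - 'X_u *: syz (p, v).
have wH q : shifted_homog (sb q) (sb p).+2 (w 0 q).
  rewrite mxE [X in _ + X]mxE [X in X + _]mxE [X in _ - X]mxE.
  apply: supp_inD; last apply: supp_inN.
    apply: (supp_inM _ (P := fun m => mdeg m = 1%N) _ (syz_homog (q := q) up)).
      by move=> a b a1 H; rewrite mdegD a1 -addnA H.
    by apply/supp_inX; rewrite mdeg1.
  apply: (supp_inM _ (P := fun m => mdeg m = 1%N) _ (syz_homog (q := q) vp)).
    by move=> a b a1 H; rewrite mdegD a1 -addnA H.
  by apply/supp_inX; rewrite mdeg1.
have wN q : (sh p <= sh q)%N -> w 0 q = 0.
  move=> pq; rewrite mxE [X in _ + X]mxE [X in X + _]mxE [X in _ - X]mxE !syzE //.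
  ring.
have w0 : w *m sg X = 0.
  by rewrite mulmxBl -!scalemxAl !syz_mul // !scaler0 subrr.
have [c [wE cN cH]] := syz_gen wN w0.
exists ('X_u *: delta_mx 0 y + c); split=> [z xz|z|].
- rewrite !mxE eqxx /=; move: xz; rewrite leqNgt syz_ht_lt negb_or xE /=.
  move=> /andP[]; rewrite -leqNgt => pz zu; rewrite cN // addr0.
  case: eqP => [zy|_]; last by rewrite mulr0.
  by move: zu; rewrite zy yE /= eqxx vu.
- rewrite !mxE eqxx /=; apply: supp_inD; last by apply: cH; rewrite /syz_deg xE.
  case: eqP => [->|_]; last by rewrite mulr0; apply: supp_in0.
  rewrite mulr1; apply/supp_inX; rewrite mdeg1 /syz_deg xE yE //=.
rewrite mulmxDl -wE -scalemxAl -rowE !rowK xE yE /w.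
by rewrite addrC subrK.
Qed.

(** Compare entries at row [p]. Syzygies attached to earlier rows vanish there, so f x_u is a
    combination of the x_v with v < u; as v differs from u, each term of [f] is itself divisible by
    such an x_v. *)
Lemma syz_colon x f (c : 'rV[S]_syz_rank) :
  (forall y, (syz_ht x <= syz_ht y)%N -> c 0 y = 0) ->
  f *: row x syz_mx = c *m syz_mx -> supp_in (hits (syz_vars x)) f.
Proof.
move=> cN /rowP/(_ (syz_at x).1); rewrite [LHS]mxE.
have := syz_atP x; case xE: (syz_at x) => [p u] /= up.
rewrite rowK xE syzE // eqxx mul1r => fE.
suff : supp_in (hits (syz_vars x)) (f * 'X_u).
  move/supp_inMX; apply: supp_inW => m [v]; rewrite inE xE /= => /andP[vp vu].
  rewrite mnmDE mnm1E; case: eqP => [uv|_]; first by move: vu; rewrite uv ltnn.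
  by rewrite addn0 => mv; exists v => //; rewrite inE xE /= vp.
rewrite fE mxE; apply: supp_in_sum => y _.
have [xy | ] := leqP (syz_ht x) (syz_ht y).
  by rewrite cN // mul0r; apply: supp_in0.
rewrite syz_ht_lt xE mxE /=; have := syz_atP y.
case: (syz_at y) => [q v] /= vq /orP[qp | /andP[/eqP/sh_inj qp vu]].
  rewrite syzE ?(ltnW qp) //; case: eqP => [pq|_].
    by move: qp; rewrite pq ltnn.
  by rewrite mul0r mulr0; apply: supp_in0.
move: vq; rewrite qp => vq; rewrite syzE // eqxx mul1r; apply/supp_inMX => m _.
exists v; first by rewrite inE xE /= vq.
by rewrite mnmDE mnm1E eqxx addn1.
Qed.

Definition next_stage : stage :=
  Stage syz_ht_inj syz_deg_mono syz_mx_homog syz_lift syz_colon.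

End Syzygies.

(** At rows from [p] on, an entry is zero or a variable. At an earlier row [q] it has degree sb p +
    1 - sb q, which is positive because degrees do not decrease along the order. *)
Lemma next_stage_minimal X (p : 'I_(ss (next_stage X))) q :
  (sg (next_stage X) p q)@_0%MM = 0.
Proof.
apply: memN_msupp_eq0; rewrite mxE; apply/negP => m0.
have := syz_atP p; case pE: (syz_at p) m0 => [r v] /= m0 vr.
have [rq | qr] := leqP (sh r) (sh q).
  move: m0; rewrite syzE //; case: eqP => _; last by rewrite mul0r msupp0.
  by rewrite mul1r msuppX inE eq_sym mnm1_eq0.
have := syz_homog (q := q) vr m0; rewrite mdeg0 add0n => H.
by have := sb_mono qr; rewrite H ltnn.
Qed.

(** * The minimal resolution obtained by iterating syzygies *)

Section Resolution.
Variables (I : S -> Prop) (D s : nat) (b : 'I_s -> nat) (g : 'cV[S]_s).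
Variables (h : 'I_s -> nat) (V : 'I_s -> {set 'I_n}).
Hypothesis h_inj : injective h.
Hypothesis b_mono : forall p q, (h p < h q)%N -> (b p <= b q)%N.
Hypothesis g_homog : forall p t, shifted_homog 0 (b p) (g p t).
Hypothesis g_lift : forall p v, v \in V p -> exists c : 'rV[S]_s,
  [/\ forall q, (h p <= h q)%N -> c 0 q = 0,
      forall q, shifted_homog (b q) (b p).+1 (c 0 q)
    & 'X_v *: row p g = c *m g].
Hypothesis g_colon : forall p f (c : 'rV[S]_s),
  (forall q, (h p <= h q)%N -> c 0 q = 0) -> f *: row p g = c *m g ->
  supp_in (hits (V p)) f.
Hypothesis g_onto : forall f, I f <-> exists v : 'rV[S]_s, v *m g = f%:M.
Hypothesis b_bound : forall p, (b p <= D)%N.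
Hypothesis b_attained : exists p, b p = D.

(** The variable sets strictly shrink from one stage to the next, so the stages are eventually empty
    and the resolution is finite. *)
Definition res_stage (i : nat) : stage :=
  iter i next_stage (Stage h_inj b_mono g_homog g_lift g_colon).

Definition res_diff i : 'M[S]_(ss (res_stage i.+1), ss (res_stage i)) :=
  sg (res_stage i.+1).

Lemma res_augm_homog p : g p 0 \is (b p).-homog.
Proof. by apply/dhomogP => m /g_homog; rewrite addn0. Qed.

Lemma res_diff_homog i p q : res_diff i p q != 0 ->
  exists2 e, sb p = (sb q + e)%N & res_diff i p q \is e.-homog.
Proof.
move=> nz; have H := @syz_mx_homog (res_stage i) p q.
have qp : (sb q <= sb p)%N.
  by have := H _ (mlead_supp nz); rewrite /= => <-; rewrite leq_addl.
exists (sb p - sb q)%N; first by rewrite subnKC.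
by apply/dhomogP => m /H /= <-; rewrite addnK.
Qed.

Lemma res_bound i (p : 'I_(ss (res_stage i))) : (sb p <= D + i)%N.
Proof.
elim: i p => [|i IHi] p; first by rewrite addn0; apply: b_bound.
by rewrite addnS; apply: IHi.
Qed.

Lemma lin_quot_has_reg : has_reg I D%:Z.
Proof.
exists (@MinGradedRes _ _ I (fun i => ss (res_stage i))
  (fun i => @sb (res_stage i)) res_diff g res_augm_homog res_diff_homog
  g_onto (@syz_exact (res_stage 0)) (fun i => @syz_exact (res_stage i.+1))
  (fun i => @next_stage_minimal (res_stage i))).
split=> [i p /=|]; last by have [p pD] := b_attained; exists 0%N, p; rewrite /= pD subr0.
have := res_bound p; lia.
Qed.

End Resolution.
End Stages.

(** * Monomial ideals with linear quotients *)

Section IdealGen.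
Variable R : comNzRingType.
Implicit Types (G J : R -> Prop).

Lemma ideal_gen_is_ideal G : is_ideal (ideal_gen G).
Proof.
split.
- by exists 0%N, (fun=> 0), (fun=> 0); split=> [[]|[]|] //; rewrite big_ord0.
- move=> x y [m [a [g [_ Gg ->]]]] [m' [a' [g' [_ Gg' ->]]]].
  exists (m + m')%N.
  exists (fun i => match split i with inl j => a j | inr j => a' j end).
  exists (fun i => match split i with inl j => g j | inr j => g' j end).
  split=> // [i|]; first by case: split.
  rewrite big_split_ord /=; congr (_ + _); apply: eq_bigr => i _.
    by rewrite -/(unsplit (inl i)) unsplitK.
  by rewrite -/(unsplit (inr i)) unsplitK.
- move=> c x [m [a [g [_ Gg ->]]]]; exists m, (fun i => c * a i), g.
  by split=> //; rewrite mulr_sumr; apply: eq_bigr => i _; rewrite mulrA.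
Qed.

Lemma mem_ideal_gen G x : G x -> ideal_gen G x.
Proof.
by exists 1%N, (fun=> 1), (fun=> x); split=> //; rewrite big_ord1 mul1r.
Qed.

Lemma ideal_sum J (I : Type) (r : seq I) (P : pred I) (F : I -> R) :
  is_ideal J -> (forall i, P i -> J (F i)) -> J (\sum_(i <- r | P i) F i).
Proof.
by move=> [J0 JD _] JF; elim/big_rec: _ => // i x Pi; apply: JD; apply: JF.
Qed.

Lemma ideal_gen_min G J : is_ideal J -> (forall x, G x -> J x) ->
  forall x, ideal_gen G x -> J x.
Proof.
move=> idJ GJ x [m [a [g [_ Gg ->]]]]; apply: ideal_sum => // i _.
by case: idJ => _ _; apply; apply: GJ.
Qed.

End IdealGen.

Section MonomialPredicates.
Variable n : nat.
Implicit Types (u v w m : 'X_{1..n}) (J : pred 'X_{1..n}).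

Definition upclosed J := forall u v, (u <= v)%MM -> J u -> J v.

(** Minimality tested only against the quotients by a single variable, which keeps it boolean; for
    upward closed [J] this is minimality under divisibility. *)
Definition min_elt J u :=
  J u && [forall j, (0 < u j)%N ==> ~~ J (u - U_(j))%MM].

Lemma min_eltP J u : upclosed J ->
  reflect (J u /\ forall v, J v -> (v <= u)%MM -> v = u) (min_elt J u).
Proof.
move=> upJ; apply: (iffP andP) => [[Ju /forallP minu]|[Ju minu]]; split=> //.
  move=> v Jv vu; apply/mnmP=> j; apply/eqP; rewrite eqn_leq.
  rewrite (mnm_lepP vu) /= leqNgt; apply/negP => vuj.
  have := minu j; rewrite (leq_ltn_trans _ vuj) //= => /negP; apply.
  apply: upJ Jv; apply/mnm_lepP => i; rewrite mnmBE mnm1E.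
  case: eqP => [<-|_]; first by rewrite subn1 -ltnS (ltn_predK vuj).
  by rewrite subn0; apply: (mnm_lepP vu).
apply/forallP=> j; apply/implyP=> uj; apply/negP => /minu.
move=> /(_ (lem_subr _ _)) /mnmP/(_ j).
by rewrite mnmBE mnm1E eqxx; lia.
Qed.

Lemma exists_min_elt J u : J u -> exists2 v, min_elt J v & (v <= u)%MM.
Proof.
elim: {u}(mdeg u) {-2}u (erefl (mdeg u)) => [|d IHd] u du Ju.
all: have [|/forallPn[j]] := boolP [forall j, (0 < u j)%N ==> ~~ J (u - U_(j))%MM].
- by move=> minu; exists u; rewrite ?lepm_refl // /min_elt Ju.
- rewrite negb_imply => /andP[uj _]; move/eqP: du.
  by rewrite mdeg_eq0 => /eqP u0; move: uj; rewrite u0 mnm0E.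
- by move=> minu; exists u; rewrite ?lepm_refl // /min_elt Ju.
rewrite negb_imply negbK => /andP[uj Juj].
have [||v minv vu] := IHd (u - U_(j))%MM; last first.
- by exists v => //; apply: lepm_trans vu (lem_subr _ _).
- by [].
- apply/eqP; rewrite -(eqn_add2r 1) -{1}(mdeg1 j) -mdegD submK ?du ?addn1 //.
  by rewrite lep1mP -lt0n.
Qed.

End MonomialPredicates.

Section MonomialIdeals.
Variables (K : fieldType) (n : nat).
Local Notation S := {mpoly K[n]}.
Implicit Types (L : S -> Prop) (M : 'X_{1..n} -> Prop).

Lemma supp_in_ideal M : (forall u v, (u <= v)%MM -> M u -> M v) ->
  is_ideal (supp_in (K := K) M).
Proof.
move=> upM; split; [exact: supp_in0 | exact: supp_inD | move=> a f Mf].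
rewrite mulrC; apply: (supp_inM (Q := fun=> True)) Mf _ => // u v Mu _.
exact: upM (lem_addr _ _) Mu.
Qed.

Lemma monomial_gen_supp M (f : S) :
  monomial_gen M f <-> supp_in (fun m => exists2 u, M u & (u <= m)%MM) f.
Proof.
split.
  apply: ideal_gen_min => [|_ [m Mm ->]]; last first.
    by apply/supp_inX; exists m; rewrite ?lepm_refl.
  by apply: supp_in_ideal => u v uv [w Mw wu]; exists w => //; apply: lepm_trans uv.
move=> fM; rewrite (mpolyE f) big_seq.
have idM := @ideal_gen_is_ideal S (fun g => exists2 m, M m & g = 'X_[m]).
apply: ideal_sum => // m /fM[u Mu um]; case: idM => _ _ idM.
rewrite -mul_mpolyC -(submK um) mpolyXD mulrA; apply: idM.
by apply: mem_ideal_gen; exists u.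
Qed.

Lemma supp_in_monomial_ideal L (J : pred 'X_{1..n}) : upclosed J ->
  (forall f, L f <-> supp_in J f) -> monomial_ideal L.
Proof.
move=> upJ LJ; exists J => f; rewrite LJ monomial_gen_supp.
split; apply: supp_inW => m; first by exists m; rewrite ?lepm_refl.
by case=> u Ju um; apply: upJ Ju.
Qed.

Lemma supp_in_mingens L (J : pred 'X_{1..n}) : upclosed J ->
  (forall f, L f <-> supp_in J f) -> forall u, mingens L u <-> min_elt J u.
Proof.
move=> upJ LJ u; have LX v : L 'X_[v] <-> J v by rewrite LJ supp_inX.
rewrite /mingens LX; split=> [[Ju minu]|/(min_eltP _ upJ)[Ju minu]].
  by apply/(min_eltP _ upJ); split=> // v /LX; apply: minu.
by split=> // v /LX; apply: minu.
Qed.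

(** * From an exchange property to linear quotients and regularity *)

Section LinearQuotients.
Variables (J : pred 'X_{1..n}) (D : nat).
Variables (disp : Order.disp_t) (T : orderType disp) (key : 'X_{1..n} -> T).
Hypothesis upJ : upclosed J.
Hypothesis key_inj : injective key.
Hypothesis key_deg : forall u v, (mdeg u < mdeg v)%N -> (key u < key v)%O.
Hypothesis Jbound : forall u, min_elt J u -> (mdeg u <= D)%N.
Hypothesis Jattained : exists2 u, min_elt J u & mdeg u = D.

(* An exchange property: it makes every colon ideal of a generator against its
   predecessors a monomial prime. *)
Hypothesis Jexch : forall u v, min_elt J u -> min_elt J v ->
  (key v < key u)%O -> exists j, (u j < v j)%N /\
  exists w, [/\ J w, (w <= u + U_(j))%MM & (key w < key u)%O].

(** The degree bound [D] is what makes the minimal generators enumerable: they are filtered from a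
    finite type of bounded monomials. *)
Definition lq_gens : seq 'X_{1..n} :=
  sort (relpre key <=%O)
    [seq u <- [seq val x | x <- enum {: 'X_{1..n < D.+1}}] | min_elt J u].

Lemma mem_lq_gens u : (u \in lq_gens) = min_elt J u.
Proof.
rewrite mem_sort mem_filter; case minu: (min_elt J u) => //=.
have uD : (mdeg u < D.+1)%N by rewrite ltnS; apply: Jbound.
by apply/mapP; exists (BMultinom uD); rewrite ?mem_enum.
Qed.

Lemma lq_gens_uniq : uniq lq_gens.
Proof.
rewrite sort_uniq filter_uniq // map_inj_uniq ?enum_uniq //; exact: val_inj.
Qed.

Lemma lq_gens_nth i j : (i < j < size lq_gens)%N ->
  (key (nth 0%MM lq_gens i) < key (nth 0%MM lq_gens j))%O.
Proof.
move=> /andP[ij js]; have is_ := ltn_trans ij js.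
rewrite lt_neqAle; apply/andP; split.
  apply/eqP => /key_inj/eqP; rewrite nth_uniq ?lq_gens_uniq //.
  by move/eqP=> E; move: ij; rewrite E ltnn.
have tr : transitive (relpre key <=%O) by move=> y x z; apply: le_trans.
apply: (sorted_ltn_nth tr) => //; apply: sort_sorted => x y; exact: le_total.
Qed.

Lemma lq_gens_lt u v : u \in lq_gens -> v \in lq_gens -> (key v < key u)%O ->
  (index v lq_gens < index u lq_gens)%N.
Proof.
move=> us vs; apply: contraTT; rewrite -leqNgt -leNgt leq_eqVlt.
case/orP=> [/eqP E | lt].
  by rewrite -(nth_index 0%MM us) -(nth_index 0%MM vs) E.
rewrite -(nth_index 0%MM us) -(nth_index 0%MM vs) ltW // lq_gens_nth //.
by rewrite lt index_mem.
Qed.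

Definition lq_vars i : {set 'I_n} :=
  [set j | has (fun w => (w <= nth 0%MM lq_gens i + U_(j))%MM) (take i lq_gens)].

Lemma lq_varsP i j : (i < size lq_gens)%N -> j \in lq_vars i ->
  exists q, (q < i)%N /\ (nth 0%MM lq_gens q <= nth 0%MM lq_gens i + U_(j))%MM.
Proof.
move=> is_; rewrite inE => /(has_nthP 0%MM)[q]; rewrite size_takel ?(ltnW is_) //.
by move=> qi; rewrite nth_take // => qj; exists q.
Qed.

(** If an earlier generator v divides m u, the exchange property gives j with u_j < v_j <= m_j +
    u_j, so x_j divides m, and u x_j is divisible by an earlier element of the ideal. *)
Lemma lq_colon i m : (i < size lq_gens)%N ->
  hits (lq_vars i) m <->
  exists2 u, u \in take i lq_gens & (u <= m + nth 0%MM lq_gens i)%MM.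
Proof.
move=> is_; set u := nth _ _ _.
have us : u \in lq_gens by apply: mem_nth.
split.
  case=> v; rewrite inE => /hasP[w wi wu] mv; exists w => //.
  apply: lepm_trans wu _; apply/mnm_lepP => t; rewrite !mnmDE mnm1E addnC.
  by rewrite leq_add2r; case: eqP => // <-.
case=> v vi vmu; have vs := mem_take vi.
have vu : (key v < key u)%O.
  move: vi => /(nthP 0%MM)[q]; rewrite size_takel ?(ltnW is_) // => qi <-.
  by rewrite nth_take // lq_gens_nth // qi.
have minu : min_elt J u by rewrite -mem_lq_gens.
have minv : min_elt J v by rewrite -mem_lq_gens.
have [j [uv [w [Jw wu kw]]]] := Jexch minu minv vu.
exists j; last first.
  by move: (mnm_lepP vmu j); rewrite mnmDE; lia.
(* The element [w] need not be a generator. A generator dividing it equals it or has smaller degree,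
   and so still precedes [u]. *)
have [w' minw' ww'] := exists_min_elt Jw.
have kw' : (key w' < key u)%O.
  apply: le_lt_trans kw; rewrite le_eqVlt.
  case: (eqVneq w' w) => [->|neq]; first by rewrite eqxx.
  rewrite key_deg ?orbT // -(submK ww') mdegD -[ltnLHS]add0n ltn_add2r lt0n.
  rewrite mdeg_eq0; apply: contra neq => /eqP w0.
  by rewrite -(submK ww') w0 add0m.
rewrite inE; apply/hasP; exists w'; last exact: lepm_trans wu.
have w's : w' \in lq_gens by rewrite mem_lq_gens.
have := lq_gens_lt us w's kw'; rewrite {1}/u index_uniq ?lq_gens_uniq //.
by rewrite in_take.
Qed.

Variable L : S -> Prop.
Hypothesis LJ : forall f, L f <-> supp_in J f.

Lemma lq_linear_quotients : linear_quotients L.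
Proof.
split; first exact: supp_in_monomial_ideal LJ.
exists lq_gens; split=> [|u|i /andP[_ is_]]; first exact: lq_gens_uniq.
  by rewrite mem_lq_gens (supp_in_mingens upJ LJ).
exists (lq_vars i) => f; set u := nth _ _ _.
have -> : colon (monomial_gen (fun v => v \in take i lq_gens))
    (monomial_gen (fun v => v = u)) f <-> supp_in (hits (lq_vars i)) f.
  transitivity (monomial_gen (fun v => v \in take i lq_gens) (f * 'X_[u])).
    split=> [H|fu].
      by apply: H; apply: mem_ideal_gen; exists u.
    move=> g; have [_ _ idM] := @ideal_gen_is_ideal S
      (fun g => exists2 m, m \in take i lq_gens & g = 'X_[m]).
    move=> [m [a [h [_ Gh ->]]]]; rewrite mulr_sumr.
    apply: ideal_sum; first exact: ideal_gen_is_ideal.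
    move=> j _; have [_ -> ->] := Gh j; rewrite mulrCA; exact: idM.
  rewrite monomial_gen_supp supp_inMX.
  by split; apply: supp_inW => m; rewrite lq_colon.
have -> : ideal_gen (fun g : S => exists2 j, j \in lq_vars i & g = 'X_j) f <->
    monomial_gen (fun v => exists2 j, j \in lq_vars i & v = U_(j)%MM) f.
  split; apply: ideal_gen_min; try exact: ideal_gen_is_ideal.
    by move=> _ [j jV ->]; apply: mem_ideal_gen; exists U_(j)%MM => //; exists j.
  by move=> _ [_ [j jV ->] ->]; apply: mem_ideal_gen; exists j.
rewrite monomial_gen_supp; split; apply: supp_inW => m.
  case=> v vV mv; exists U_(v)%MM; first by exists v.
  by rewrite lep1mP -lt0n.
by case=> _ [v vV ->]; rewrite lep1mP -lt0n; exists v.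
Qed.

Lemma lq_has_reg : has_reg L D%:Z.
Proof.
pose s := size lq_gens; pose us (p : 'I_s) := nth 0%MM lq_gens p.
have rowE (p : 'I_s) : row p (\col_q 'X_[us q]) = 'X_[us p]%:M :> 'M[S]_1.
  by apply/matrixP=> i j; rewrite !mxE !ord1.
have mulE (c : 'rV[S]_s) : c *m (\col_q 'X_[us q]) = (\sum_q c 0 q * 'X_[us q])%:M.
  apply/matrixP=> i j; rewrite !mxE !ord1 eqxx mulr1n.
  by apply: eq_bigr => q _; rewrite mxE.
have usJ p : J (us p).
  have : us p \in lq_gens by apply: mem_nth.
  by rewrite mem_lq_gens => /(min_eltP _ upJ)[].
apply: (@lin_quot_has_reg K n L D s (fun p => mdeg (us p)) (\col_q 'X_[us q])
  val (fun p => lq_vars p)).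
- exact: val_inj.
- move=> p q pq; have := @lq_gens_nth p q; rewrite pq ltn_ord => /(_ isT).
  rewrite leqNgt; apply: contraL => /key_deg; rewrite -leNgt; exact: ltW.
- by move=> p t; rewrite mxE; apply/supp_inX; rewrite addn0.
- move=> p v vp; have [q [qp qv]] := lq_varsP (ltn_ord p) vp.
  have qs : (q < s)%N by apply: ltn_trans qp (ltn_ord p).
  pose q' := Ordinal qs.
  (* The lift has a single term: x_v u_p is a monomial multiple of one earlier generator. *)
  exists ('X_[us p + U_(v) - us q'] *: delta_mx 0 q'); split=> [r pr|r|].
  + rewrite !mxE eqxx /=; case: eqP => [rq|_]; last by rewrite mulr0.
    by move: pr; rewrite rq /= leqNgt qp.
  + rewrite !mxE eqxx /=; case: eqP => [->|_]; last by rewrite mulr0; apply: supp_in0.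
    rewrite mulr1; apply/supp_inX.
    by rewrite -mdegD submK // mdegD mdeg1 addn1.
  rewrite rowE mulE (bigD1 q') //= big1 ?addr0 => [|r rq].
    rewrite !mxE !eqxx mulr1 -mpolyXD submK // addmC mpolyXD.
    by rewrite scale_scalar_mx.
  by rewrite !mxE (negbTE rq) andbF mulr0 mul0r.
- move=> p f c cN; rewrite rowE mulE scale_scalar_mx => fE.
  have {}fE : f * 'X_[us p] = \sum_q c 0 q * 'X_[us q].
    by move/matrixP/(_ 0 0): fE; rewrite !mxE eqxx !mulr1n.
  have : supp_in (fun m => exists2 u, u \in take p lq_gens & (u <= m)%MM)
      (f * 'X_[us p]).
    rewrite fE; apply: supp_in_sum => q _.
    have [pq|qp] := leqP p q; first by rewrite cN // mul0r; apply: supp_in0.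
    apply/supp_inMX => m _; exists (us q); last exact: lem_addl.
    by rewrite /us -(nth_take 0%MM qp); apply: mem_nth; rewrite size_takel // ltnW.
  move/supp_inMX; apply: supp_inW => m H; exact/lq_colon.
- move=> f; rewrite LJ; split=> [fJ | [c]].
    suff [c ->] : exists c : 'rV[S]_s, f = \sum_q c 0 q * 'X_[us q].
      by exists c.
    rewrite (mpolyE f); move: fJ; rewrite /supp_in.
    elim: (msupp f) => [|m r IHr] rJ.
      by exists 0; rewrite big_nil big1 // => q _; rewrite mxE mul0r.
    have [|c cE] := IHr; first by move=> m' m'r; apply: rJ; rewrite inE m'r orbT.
    have [w minw wm] := exists_min_elt (rJ m (mem_head _ _)).
    rewrite -mem_lq_gens in minw; rewrite -index_mem in minw.
    pose q := Ordinal (minw : index w lq_gens < s)%N.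
    have qw : us q = w by apply: nth_index; rewrite -index_mem.
    exists ((f@_m *: 'X_[m - w]) *: delta_mx 0 q + c).
    rewrite big_cons cE.
    under [RHS]eq_bigr do rewrite mxE mulrDl.
    rewrite big_split /=; congr (_ + _).
    rewrite (bigD1 q) //= big1 ?addr0 => [|r' rq].
      by rewrite !mxE !eqxx mulr1 qw -scalerAl -mpolyXD submK.
    by rewrite !mxE (negbTE rq) andbF mulr0 mul0r.
  rewrite mulE => /matrixP/(_ 0 0); rewrite !mxE eqxx !mulr1n => <-.
  apply: supp_in_sum => q _; apply/supp_inMX => m _.
  exact: upJ (lem_addl _ _) (usJ q).
- by move=> p; apply: Jbound; rewrite -mem_lq_gens; apply: mem_nth.
have [u minu uD] := Jattained; rewrite -mem_lq_gens in minu.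
have us_ := minu; rewrite -index_mem in us_.
by exists (Ordinal us_); rewrite /us /= nth_index.
Qed.

End LinearQuotients.
End MonomialIdeals.

(** * Ordinary and symbolic powers of squarefree monomial ideals *)

Section Localization.
Variable R : idomainType.
Variables (P J : R -> Prop).
Hypotheses (primeP : is_prime_ideal P) (idJ : is_ideal J).

Lemma prime_compl_prod (I : Type) (r : seq I) (C : pred I) (F : I -> R) :
  (forall i, C i -> ~ P (F i)) -> ~ P (\prod_(i <- r | C i) F i).
Proof.
case: primeP => _ P1 PM CF; elim/big_rec: _ => // i x Ci Px /PM[] //.
exact: CF.
Qed.

(** A finite sum of fractions is cleared by the product of its denominators, which avoids the prime
    [P]. *)
Lemma loc_ideal_tofracP f :
  loc_ideal P J (tofrac f) <-> exists2 s, ~ P s & J (s * f).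
Proof.
have [[P0 _ _] P1 PM] := primeP; have [J0 JD JM] := idJ.
have nz s : ~ P s -> tofrac s != 0.
  by move=> Ps; rewrite tofrac_eq0; apply/eqP => s0; apply: Ps; rewrite s0.
split=> [[m [a [g [loc_a Jg fE]]]] | [s Ps Jsf]].
  suff [s Ps [h Jh hE]] : exists2 s, ~ P s &
      exists2 h, J h & tofrac s * (\sum_(i < m) a i * g i) = tofrac h.
    exists s => //; move: hE; rewrite -fE -tofracM => /eqP.
    by rewrite tofrac_eq => /eqP ->.
  elim/big_rec: _ => [|i x _ [s Ps [h Jh hE]]].
    by exists 1 => //; exists 0; rewrite ?mulr0 ?tofrac0.
  have [b [t [Pt ->]]] := loc_a i; have [c Jc ->] := Jg i.
  exists (s * t); first by move/PM => [].
  exists (s * b * c + t * h); first by apply: JD; apply: JM.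
  rewrite mulrDr tofracD; congr (_ + _); last first.
    by rewrite [RHS]tofracM -hE tofracM mulrA [tofrac s * _]mulrC.
  by rewrite !tofracM; field; apply: nz.
exists 1%N, (fun=> tofrac 1 / tofrac s), (fun=> tofrac (s * f)); split.
- by move=> _; exists 1, s.
- by move=> _; exists (s * f).
by rewrite big_ord1 tofrac1 div1r tofracM mulKf // nz.
Qed.

End Localization.

(** Over a domain, multiplying by a polynomial with nonzero constant coefficient preserves the order
    of vanishing at zero. *)
Lemma poly_low_coef_cancel (R : idomainType) (p q : {poly R}) k :
  p`_0 != 0 -> (forall e, (e < k)%N -> (p * q)`_e = 0) ->
  forall e, (e < k)%N -> q`_e = 0.
Proof.
move=> p0 pq; elim/ltn_ind=> e IH ek; have := pq e ek.
rewrite coefM big_ord_recl /= subn0 big1 ?addr0 => [/eqP|i _].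
  by rewrite mulf_eq0 (negbTE p0) => /eqP.
have := ltn_ord i; rewrite /bump add1n => ie; rewrite IH ?mulr0 //; lia.
Qed.

(** * Degree in a subset of the variables, and powers of variable primes *)

Section Weights.
Variables (K : fieldType) (n : nat) (A : {set 'I_n}).
Local Notation S := {mpoly K[n]}.

Definition weight (m : 'X_{1..n}) : nat := (\sum_(i in A) m i)%N.

Lemma weightD m1 m2 : weight (m1 + m2)%MM = (weight m1 + weight m2)%N.
Proof. by rewrite /weight -big_split; apply: eq_bigr => i _; rewrite mnmDE. Qed.

Lemma weightU i : weight U_(i)%MM = (i \in A).
Proof.
rewrite /weight; case iA: (i \in A).
  rewrite (bigD1 i) //= mnm1E eqxx big1 // => j /andP[_ ji].
  by rewrite mnm1E eq_sym (negbTE ji).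
by apply: big1 => j jA; rewrite mnm1E; case: eqP => // ij; rewrite ij jA in iA.
Qed.

Lemma leq_weight u v : (u <= v)%MM -> (weight u <= weight v)%N.
Proof. by move/mnm_lepP=> uv; apply: leq_sum. Qed.

Lemma weight_gt0 m : hits A m <-> (0 < weight m)%N.
Proof.
split=> [[i iA mi] | ]; first by rewrite /weight (bigD1 i) //= addn_gt0 mi.
by rewrite lt0n sum_nat_eq0 negb_forall_in => /exists_inP[i iA mi];
  exists i; rewrite // lt0n.
Qed.

(* The grading by [weight], as the homomorphism x_i |-> x_i T for i in A. *)
Definition weight_hom : S -> {poly S} :=
  mmap (polyC \o @mpolyC n K) (fun i => ('X_i)%:P * 'X^(i \in A)).

Lemma weight_homM : {morph weight_hom : f g / f * g}.
Proof. by move=> f g; rewrite /weight_hom rmorphM. Qed.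

Lemma weight_homE f :
  weight_hom f = \sum_(m <- msupp f) ((f@_m *: 'X_[m])%:P * 'X^(weight m)).
Proof.
apply: eq_bigr => m _; rewrite /= -mul_mpolyC polyCM -mulrA; congr (_ * _).
rewrite /mmap1 /weight.
under [LHS]eq_bigr do rewrite exprMn -exprM -polyC_exp.
rewrite big_split /= -rmorph_prod -mpolyXE_id; congr (_ * _).
rewrite -expr_sum; congr ('X^_); rewrite [RHS]big_mkcond.
by apply: eq_bigr => i _; case: (i \in A); rewrite ?mul1n ?mul0n.
Qed.

Lemma coef_weight_hom f e m :
  ((weight_hom f)`_e)@_m = if weight m == e then f@_m else 0.
Proof.
rewrite weight_homE coef_sum raddf_sum /=.
under eq_bigr do rewrite coefCM coefXn.
case mf: (m \in msupp f); last first.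
  rewrite (memN_msupp_eq0 (negbT mf)) if_same big_seq big1 // => m' m'f.
  case: eqP => _; rewrite ?mulr0 ?mcoeff0 // mulr1 mcoeffZ mcoeffX.
  by case: eqP => [E|_]; rewrite ?mulr0 // -E m'f in mf *.
rewrite (bigD1_seq m) ?msupp_uniq //= big1 ?addr0 => [|m' m'm].
  rewrite eq_sym; case: eqP => _; last by rewrite mulr0 mcoeff0.
  by rewrite mulr1 mcoeffZ mcoeffX eqxx mulr1.
case: eqP => _; rewrite ?mulr0 ?mcoeff0 // mulr1 mcoeffZ mcoeffX.
by rewrite (negbTE m'm) mulr0.
Qed.

Lemma weight_geP f k : supp_in (fun m => (k <= weight m)%N) f <->
  forall e, (e < k)%N -> (weight_hom f)`_e = 0.
Proof.
split=> [fk e ek | fk m mf].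
  apply/mpolyP=> m; rewrite coef_weight_hom mcoeff0; case: eqP => // me.
  by apply: memN_msupp_eq0; apply/negP => /fk; rewrite me leqNgt ek.
rewrite leqNgt; apply/negP => /fk /mpolyP/(_ m).
rewrite coef_weight_hom eqxx mcoeff0 => /eqP.
by rewrite mcoeff_eq0 mf.
Qed.

(** The powers of (x_i, i in A) are primary: an [s] outside this prime has a term of weight zero, so
    its image under [weight_hom] has nonzero constant coefficient. *)
Lemma weight_ge_cancel (s f : S) k : ~ supp_in (hits A) s ->
  supp_in (fun m => (k <= weight m)%N) (s * f) ->
  supp_in (fun m => (k <= weight m)%N) f.
Proof.
move=> sA; rewrite !weight_geP weight_homM; apply: poly_low_coef_cancel.
apply/eqP => s0; apply: sA.
apply: (@supp_inW _ _ (fun m => (1 <= weight m)%N)) => [m /weight_gt0 //|].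
by apply/weight_geP => -[].
Qed.

Lemma var_ideal_prime : is_prime_ideal (supp_in (K := K) (hits A)).
Proof.
split.
- apply: supp_in_ideal => u v uv [i iA ui]; exists i => //.
  exact: leq_trans ui (mnm_lepP uv i).
- by rewrite -mpolyX0 => /supp_inX[i _]; rewrite mnm0E.
move=> x y xyA; case: (classic (supp_in (hits A) x)) => xA; [by left | right].
apply: (@supp_inW _ _ (fun m => (1 <= weight m)%N)) => [m /weight_gt0 //|].
by apply: weight_ge_cancel xA _; apply: supp_inW xyA => m /weight_gt0.
Qed.

End Weights.

(** * Exponents of ordinary and symbolic powers *)

Section SquarefreeMonomialIdeals.
Variables (K : fieldType) (n : nat).
Local Notation S := {mpoly K[n]}.
Variable G : 'X_{1..n} -> Prop.

Definition above (M : 'X_{1..n} -> Prop) (m : 'X_{1..n}) : Prop :=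
  exists2 u, M u & (u <= m)%MM.

Lemma above_up M u v : (u <= v)%MM -> above M u -> above M v.
Proof. by move=> uv [w Mw wu]; exists w => //; apply: lepm_trans uv. Qed.

Fixpoint sum_of (k : nat) (u : 'X_{1..n}) : Prop :=
  if k is k'.+1 then exists b v, [/\ G b, sum_of k' v & u = (b + v)%MM]
  else u = 0%MM.

Definition blocking (A : {set 'I_n}) : Prop := forall b, G b -> hits A b.

Lemma sum_of_weight A k u : blocking A -> sum_of k u -> (k <= weight A u)%N.
Proof.
move=> trA; elim: k u => // k IHk u [b [v [/trA/weight_gt0 bA /IHk vA ->]]].
by rewrite weightD; lia.
Qed.

Lemma exists_min_blocking A : blocking A ->
  exists2 A0 : {set 'I_n}, A0 \subset A &
  blocking A0 /\ forall i, i \in A0 -> ~ blocking (A0 :\ i).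
Proof.
have [m] := ubnP #|A|; elim: m A => // m IHm A Am trA.
case: (classic (exists2 i, i \in A & blocking (A :\ i))) => [[i iA tri]|H].
  have [|A0 A0A A0P] := IHm _ _ tri; first by rewrite (cardsD1 i A) iA in Am.
  by exists A0 => //; apply: subset_trans A0A (subD1set _ _).
by exists A => //; split=> // i iA tri; apply: H; exists i.
Qed.

Variable I : S -> Prop.
Hypothesis IG : forall f, I f <-> supp_in (above G) f.
Hypothesis Gsqfree : forall b i, G b -> (b i <= 1)%N.

Lemma gens_ideal : is_ideal I.
Proof.
have [I0 ID IM] := @supp_in_ideal K n _ (@above_up G).
by split=> [|x y|a x]; rewrite !IG; [|exact: ID|exact: IM].
Qed.

Lemma ideal_powE k f : ideal_pow I k f <-> supp_in (above (sum_of k)) f.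
Proof.
have upk := @above_up (sum_of k).
split.
  apply: ideal_gen_min; first exact: supp_in_ideal.
  move=> _ [t It ->] {upk}; elim: k t It => [|k IHk] t It.
    by rewrite big_ord0 -mpolyX0; apply/supp_inX; exists 0%MM; rewrite ?lepm_refl.
  rewrite big_ord_recl; apply: supp_inM (iffLR (IG _) (It ord0)) (IHk _ _).
    move=> a c [b Gb ba] [v kv vc]; exists (b + v)%MM; first by exists b, v.
    apply/mnm_lepP=> i; rewrite !mnmDE leq_add //; exact: mnm_lepP.
  by move=> i; apply: It.
have idk := @ideal_gen_is_ideal S (fun x => exists2 t : 'I_k -> S,
    forall i, I (t i) & x = \prod_(i < k) t i).
move=> fk; rewrite (mpolyE f) big_seq; apply: ideal_sum => // m /fk[u ku um].
have [_ _ idM] := idk; rewrite -(submK um) mpolyXD scalerAl; apply: idM.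
apply: mem_ideal_gen; elim: k u ku {f fk um idk upk} => [|k IHk] u.
  by move=> ->; exists (fun=> 0); [case | rewrite big_ord0 mpolyX0].
move=> [b [v [Gb /IHk[t It tE] ->]]].
exists (fun i => if unlift ord0 i is Some j then t j else 'X_[b]).
  move=> i; case: unliftP => [j _ //|_]; apply/IG/supp_inX; exists b => //.
  exact: lepm_refl.
rewrite big_ord_recl unlift_none mpolyXD tE; congr (_ * _).
by apply: eq_bigr => i _; rewrite liftK.
Qed.

(** The prime is the annihilator of the product f of all variables outside [A]. By minimality each i
    in A admits a generator meeting [A] only in i; being squarefree, it divides x_i f. *)
Lemma min_blocking_associated A : blocking A ->
  (forall i, i \in A -> ~ blocking (A :\ i)) ->
  associated_prime I (supp_in (hits A)).
Proof.
move=> trA minA; split; first exact: var_ideal_prime.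
exists 'X_[[multinom (i \notin A) : nat | i < n]] => f.
rewrite IG supp_inMX; split; apply: supp_inW => m.
  move=> [i iA mi]; have /not_all_ex_not[b] := minA i iA.
  move/(imply_to_and (G b)) => [Gb bA]; exists b => //; apply/mnm_lepP=> j.
  rewrite mnmDE mnmE; case: (boolP (j \in A)) => jA; last first.
    by rewrite (leq_trans (Gsqfree j Gb)) ?leq_addl.
  rewrite addn0; case: (eqVneq j i) => [->|ji].
    exact: leq_trans (Gsqfree i Gb) mi.
  case: (posnP (b j)) => [-> //|bj]; case: bA; exists j => //.
  by rewrite in_setD1 ji.
move=> [b /trA[i iA bi] bm]; exists i => //.
by move: (mnm_lepP bm i); rewrite mnmDE mnmE iA addn0; apply: leq_trans.
Qed.

(** Only the set of variables contained in [P] is extracted, together with generators meeting it in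
    exactly one prescribed variable; the localization argument uses nothing more of [P]. *)
Lemma associated_blocking P : associated_prime I P ->
  exists2 A : {set 'I_n}, forall i, i \in A <-> P 'X_i &
  blocking A /\ forall i, i \in A -> exists b,
    [/\ G b, (0 < b i)%N & forall j, j \in A -> j != i -> b j = 0%N].
Proof.
move=> [primeP [g Pg]]; have [[_ _ PMl] P1 PM] := primeP.
pose A := [set i | if excluded_middle_informative (P 'X_i) then true else false].
have AP i : i \in A <-> P 'X_i.
  by rewrite inE; case: excluded_middle_informative.
exists A => //; split=> [b Gb|i iA].
  apply: NNPP => bA.
  have Xb : P 'X_[b].
    apply/Pg; rewrite mulrC; have [_ _ IM] := gens_ideal; apply: IM.
    by apply/IG/supp_inX; exists b; rewrite ?lepm_refl.
  move: Xb; rewrite mpolyXE_id; apply: (prime_compl_prod primeP) => i _.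
  case: (posnP (b i)) => [-> //|bi] Xi; apply: bA; exists i => //.
  by apply/AP; elim: (b i) Xi => // e IHe; rewrite exprS => /PM[].
have : ~ I g by move=> Ig; apply: P1; apply/Pg; rewrite mul1r.
rewrite IG => /not_all_ex_not[m /(imply_to_and (m \in msupp g))[mg mI]].
(* Here [m] is a term of [g] outside [I] while x_j m lies in [I]. Squarefreeness then excludes x_j
   from [m], so [m] involves no variable of [A]. *)
have lift_m j : j \in A -> exists b, [/\ G b, (b <= m + U_(j))%MM & m j = 0%N].
  move=> /AP/Pg; rewrite mulrC IG => /(_ _ (mem_msuppMX U_(j) mg))[b Gb bm].
  exists b; split=> //; apply/eqP; rewrite -leqn0 leqNgt; apply/negP => mj.
  apply: mI; exists b => //; apply/mnm_lepP => t.
  have := mnm_lepP bm t; rewrite mnmDE mnm1E; case: eqP => [<- _|_].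
    exact: leq_trans (Gsqfree j Gb) mj.
  by rewrite addn0.
have [b [Gb bm mi]] := lift_m i iA; exists b; split=> // [|j jA ji].
  rewrite lt0n; apply/negP => /eqP bi; apply: mI; exists b => //.
  apply/mnm_lepP => t; have := mnm_lepP bm t; rewrite mnmDE mnm1E.
  by case: eqP => [<-|_]; rewrite ?bi ?addn0.
have [_ [_ _ mj]] := lift_m j jA.
move: (mnm_lepP bm j); rewrite mnmDE mnm1E mj eq_sym (negbTE ji).
by rewrite leqn0 => /eqP.
Qed.

(* Each unit of weight is completed to a generator by the variables outside A,
   which are invertible in the localization. *)
Lemma weight_sum_of (A : {set 'I_n}) (B : 'I_n -> 'X_{1..n}) k m :
  (forall i, i \in A -> G (B i) /\ (0 < B i i)%N) ->
  (k <= weight A m)%N ->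
  above (sum_of k) (m + (\sum_(i in A) (B i - U_(i))%MM) *+ k)%MM.
Proof.
move=> BA; elim: k m => [|k IHk] m km.
  exists 0%MM; first by [].
  by apply/mnm_lepP=> i; rewrite mnm0E.
have [i iA mi] : hits A m by apply/weight_gt0; apply: leq_trans km.
have [GB Bi] := BA i iA.
have Um : (U_(i) <= m)%MM by rewrite lep1mP -lt0n.
have [|u ku um] := IHk (m - U_(i))%MM.
  by move: km; rewrite -{1}(submK Um) weightD weightU iA; lia.
exists (B i + u)%MM; first by exists (B i), u.
apply/mnm_lepP=> j; move: (mnm_lepP um j).
have : ((B i - U_(i))%MM j <= (\sum_(i in A) (B i - U_(i)))%MM j)%N.
  by rewrite mnm_sumE (bigD1 i) //= leq_addr.
rewrite mulmSr !mnmDE !mnmBE mnm1E.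
by case: eqP => [<-|_]; lia.
Qed.

(** A minimal blocking set inside [A] gives an associated prime, and primariness removes the
    denominator. Conversely, a denominator made of variables outside [P] completes every term of [f]
    to an element of the ordinary power. *)
Theorem symb_powE k f : symb_pow I k f <->
  supp_in (fun m => forall A, blocking A -> (k <= weight A m)%N) f.
Proof.
have idk : is_ideal (ideal_pow I k) by apply: ideal_gen_is_ideal.
split=> [fk m mf A trA | fk P assP].
  have [A0 A0A [trA0 minA0]] := exists_min_blocking trA.
  have assP := min_blocking_associated trA0 minA0.
  have [primeP _] := assP.
  have /(loc_ideal_tofracP primeP idk)[s sA0] := fk _ assP.
  rewrite ideal_powE => sf; apply: (@leq_trans (weight A0 m)).
    apply: (weight_ge_cancel sA0 _ mf); apply: supp_inW sf => u [v kv vu].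
    exact: leq_trans (sum_of_weight trA0 kv) (leq_weight A0 vu).
  rewrite /weight [leqRHS](big_setID A0) /= (setIidPr A0A); exact: leq_addr.
have [primeP _] := assP; have [A AP [trA exB]] := associated_blocking assP.
have [B BP] : exists B : 'I_n -> 'X_{1..n}, forall i, i \in A ->
    [/\ G (B i), (0 < B i i)%N & forall j, j \in A -> j != i -> B i j = 0%N].
  exists (fun i => epsilon (inhabits 0%MM) (fun b =>
    [/\ G b, (0 < b i)%N & forall j, j \in A -> j != i -> b j = 0%N])).
  by move=> i /exB /(epsilon_spec (inhabits 0%MM)).
apply/(loc_ideal_tofracP primeP idk).
(* As [B i] is squarefree and meets [A] only in i, this monomial has no variable of [A] and hence
   avoids [P]; its k-th multiple pays for k completions. *)
exists 'X_[(\sum_(i in A) (B i - U_(i))%MM) *+ k].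
  rewrite mpolyXE_id; apply: (prime_compl_prod primeP) => j _.
  have [_ P1 PM] := primeP.
  case: (boolP (j \in A)) => jA.
    rewrite mulmnE mnm_sumE big1 ?mul0n ?expr0 // => i iA.
    have [GB Bi BN] := BP i iA; rewrite mnmBE mnm1E.
    case: (eqVneq j i) => [->|ji]; last by rewrite BN.
    by rewrite ?eqxx /=; have := Gsqfree i GB; lia.
  have Xe e : P ('X_j ^+ e) -> P 'X_j by elim: e => // e IHe; rewrite exprS => /PM[].
  by move/Xe/AP => jA'; rewrite jA' in jA.
rewrite mulrC ideal_powE; apply/supp_inMX; apply: supp_inW fk => m /(_ _ trA).
by apply: weight_sum_of => i /BP[].
Qed.

End SquarefreeMonomialIdeals.

(** * Loops and parallel classes *)

Section Exchange.
Variable c : nat.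
Implicit Types (J : pred 'X_{1..c}) (psi : 'X_{1..c} -> nat) (y z w : 'X_{1..c}).

(** The tie-breaker [psi] between degree and monomial order is a parameter because one model needs a
    nonconstant one. *)
Definition precedes psi z y : Prop :=
  (mdeg z < mdeg y)%N \/ mdeg z = mdeg y /\
  ((psi z < psi y)%N \/ psi z = psi y /\ (z < y)%O).

Definition exchange psi J : Prop := forall y z,
  min_elt J y -> min_elt J z -> precedes psi z y ->
  exists2 t, (y t < z t)%N &
  exists w, [/\ J w, (w <= y + U_(t))%MM & precedes psi w y].

End Exchange.

Section ClassMap.
Variables (n c : nat) (cl : 'I_n -> option 'I_c).
Implicit Types (u v : 'X_{1..n}) (y z : 'X_{1..c}) (t : 'I_c).

Definition class_sum u : 'X_{1..c} := [multinom (\sum_(i | cl i == Some t) u i)%N | t < c].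

Definition loopfree u : Prop := forall i, cl i = None -> u i = 0%N.

Lemma class_sumD u v : class_sum (u + v)%MM = (class_sum u + class_sum v)%MM.
Proof.
apply/mnmP=> t; rewrite mnmDE !mnmE -big_split.
by apply: eq_bigr => i _; rewrite mnmDE.
Qed.

Lemma class_sum0 : class_sum 0%MM = 0%MM.
Proof. by apply/mnmP=> t; rewrite !mnmE big1 // => i _; rewrite mnm0E. Qed.

Lemma class_sumMn u k : class_sum (u *+ k)%MM = (class_sum u *+ k)%MM.
Proof. by elim: k => [|k IHk]; rewrite ?mulm0n ?class_sum0 // !mulmS class_sumD IHk. Qed.

Lemma class_sumU i : class_sum U_(i)%MM = if cl i is Some t then U_(t)%MM else 0%MM.
Proof.
apply/mnmP=> t; rewrite mnmE; case: (altP (cl i =P Some t)) => it.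
  rewrite it (bigD1 i) ?it //= !mnm1E !eqxx big1 // => j /andP[_ ji].
  by rewrite mnm1E eq_sym (negbTE ji).
rewrite big1 => [|j jt]; last first.
  by rewrite mnm1E; case: eqP => // ij; rewrite ij jt in it.
case: (cl i) it => [s|]; last by rewrite mnm0E.
by rewrite mnm1E => st; case: eqP => // ts; rewrite ts eqxx in st.
Qed.

Lemma class_sumB v u : (v <= u)%MM ->
  class_sum (u - v)%MM = (class_sum u - class_sum v)%MM.
Proof. by move=> vu; rewrite -{2}(submK vu) class_sumD addmK. Qed.

Lemma class_sum_le u v : (u <= v)%MM -> (class_sum u <= class_sum v)%MM.
Proof. by move=> uv; rewrite -(submK uv) class_sumD lem_addl. Qed.

Lemma class_sum_gt0 u t :
  (0 < class_sum u t)%N <-> exists2 i, cl i = Some t & (0 < u i)%N.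
Proof.
rewrite mnmE; split=> [|[i it ui]]; last first.
  by rewrite (bigD1 i) /= ?it // addn_gt0 ui.
by rewrite lt0n sum_nat_eq0 negb_forall_in => /exists_inP[i /eqP it ui];
  exists i; rewrite // lt0n.
Qed.

Lemma mdeg_class_sum u : loopfree u -> mdeg (class_sum u) = mdeg u.
Proof.
move=> lu; rewrite !mdegE; under eq_bigr do rewrite mnmE.
rewrite (exchange_big_dep predT) //=; apply: eq_bigr => i _.
case it: (cl i) => [t|]; last by rewrite lu // big1.
by rewrite (big_pred1 t) // => s; rewrite eq_sym.
Qed.

(** Variables are removed from [u] one at a time: loops, which leave the class sums unchanged, and
    then variables of a class whose sum still exceeds [y]. *)
Lemma class_sum_lift u y : (y <= class_sum u)%MM ->
  exists v, [/\ (v <= u)%MM, loopfree v & class_sum v = y].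
Proof.
have [m] := ubnP (mdeg u); elim: m u => // m IHm u um yu.
have step i : (0 < u i)%N -> (y <= class_sum (u - U_(i))%MM)%MM ->
    exists v, [/\ (v <= u)%MM, loopfree v & class_sum v = y].
  move=> ui yui; have Ui : (U_(i) <= u)%MM by rewrite lep1mP -lt0n.
  have [|v [vu lv vy]] := IHm _ _ yui.
    by move: um; rewrite -{1}(submK Ui) mdegD mdeg1; lia.
  by exists v; split=> //; apply: lepm_trans vu (lem_subr _ _).
case: (classic (exists2 i, cl i = None & (0 < u i)%N)) => [[i iN ui]|noN].
  apply: (step i ui); rewrite class_sumB ?lep1mP -?lt0n // class_sumU iN.
  by rewrite subm0.
have lu : loopfree u.
  by move=> i iN; case: (posnP (u i)) => // ui; case: noN; exists i.
have [->|yneq] := eqVneq y (class_sum u); first by exists u; rewrite lepm_refl.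
have [t yt] : exists t, (y t < class_sum u t)%N.
  apply: NNPP => not_t; case/eqP: yneq; apply/mnmP=> t; apply/eqP.
  rewrite eqn_leq (mnm_lepP yu) /= leqNgt; apply/negP => lt; apply: not_t.
  by exists t.
have [i it ui] : exists2 i, cl i = Some t & (0 < u i)%N.
  by apply/class_sum_gt0; apply: leq_trans yt.
apply: (step i ui); rewrite class_sumB ?lep1mP -?lt0n // class_sumU it.
apply/mnm_lepP=> s; rewrite mnmBE mnm1E; case: eqP => [<-|_].
  by rewrite subn1 -ltnS prednK // (leq_trans _ yt).
by rewrite subn0; apply: (mnm_lepP yu).
Qed.

Lemma class_sum_exists u z t : (class_sum u t < z t)%N ->
  forall v, class_sum v = z -> exists2 i, cl i = Some t & (u i < v i)%N.
Proof.
move=> lt v vz; apply: NNPP => H; move: lt; rewrite -vz ltnNge => /negP; apply.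
rewrite !mnmE; apply: leq_sum => i /eqP it; rewrite leqNgt; apply/negP => uv.
by apply: H; exists i.
Qed.

(** * Lifting generators and exchange along a class map *)

Section LiftIdeal.
Variables (J : pred 'X_{1..c}) (psi : 'X_{1..c} -> nat).
Hypothesis upJ : upclosed J.

Definition lift_pred : pred 'X_{1..n} := fun u => J (class_sum u).

Lemma lift_pred_up : upclosed lift_pred.
Proof. by move=> u v /class_sum_le; apply: upJ. Qed.

Lemma lift_min_elt u : min_elt lift_pred u <-> loopfree u /\ min_elt J (class_sum u).
Proof.
rewrite /min_elt /lift_pred; split=> [/andP[Ju /forallP minu]|[lu]].
  rewrite Ju; split.
    move=> i iN; have := minu i; case: posnP => // ui /=.
    rewrite class_sumB ?lep1mP -?lt0n // class_sumU iN subm0 Ju //.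
  apply/forallP=> t; apply/implyP => /class_sum_gt0[i it ui].
  by have := minu i; rewrite ui class_sumB ?lep1mP -?lt0n // class_sumU it.
move=> /andP[-> /forallP minu]; apply/forallP=> i; apply/implyP=> ui.
case it: (cl i) => [t|]; last by move: ui; rewrite lu.
have := minu t; rewrite class_sumB ?lep1mP -?lt0n // class_sumU it.
by move=> /implyP; apply; apply/class_sum_gt0; exists i.
Qed.

(** The order of the model pulled back along [class_sum]; the last component separates generators
    with equal class sums, which makes the key injective. *)
Definition class_key u : (nat *l (nat *l ('X_{1..c} *l 'X_{1..n})))%type :=
  (mdeg u, (psi (class_sum u), (class_sum u, u))).

Lemma class_key_inj : injective class_key.
Proof. by move=> u v []. Qed.

Lemma class_key_lt v u : (class_key v < class_key u)%O <->
  (mdeg v < mdeg u)%N \/ mdeg v = mdeg u /\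
  ((psi (class_sum v) < psi (class_sum u))%N \/
   psi (class_sum v) = psi (class_sum u) /\
   ((class_sum v < class_sum u)%O \/ class_sum v = class_sum u /\ (v < u)%O)).
Proof.
rewrite !ltEprodlexi /= !leEnat.
case: ltngtP => [lt|gt|->] /=; [by split=> //; left|by split=> // -[|[]] //; lia|].
case: ltngtP => [lt|gt|->] /=.
- by split=> // _; right; split=> //; left.
- by split=> // -[|[_ [|[]]]]; lia.
rewrite [(class_sum u <= _)%O]le_eqVlt.
case: (ltgtP (class_sum v) (class_sum u)) => [lt|gt|->] /=.
- by split=> // _; right; split=> //; right; split=> //; left.
- split=> // -[|[_ [|[_ [|[E]]]]]]; rewrite ?ltnn //.
  by rewrite E ltxx in gt.
split=> [lt|]; first by do !(right; split).
by case=> [|[_ [|[_ [|[_]]]]]]; rewrite ?ltnn ?ltxx.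
Qed.

Lemma class_key_deg u v : (mdeg u < mdeg v)%N -> (class_key u < class_key v)%O.
Proof. by move=> uv; apply/class_key_lt; left. Qed.

Lemma precedes_class_key v u : mdeg (class_sum v) = mdeg v ->
  mdeg (class_sum u) = mdeg u ->
  precedes psi (class_sum v) (class_sum u) -> (class_key v < class_key u)%O.
Proof.
move=> vE uE; rewrite /precedes vE uE => H; apply/class_key_lt.
case: H => [|[? [|[? ?]]]]; first by left.
  by right; split=> //; left.
by right; split=> //; right; split=> //; left.
Qed.

Lemma lift_exchange : exchange psi J -> forall u v,
  min_elt lift_pred u -> min_elt lift_pred v -> (class_key v < class_key u)%O ->
  exists j, (u j < v j)%N /\
  exists w, [/\ lift_pred w, (w <= u + U_(j))%MM & (class_key w < class_key u)%O].
Proof.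
move=> exJ u v /lift_min_elt[lu minu] /lift_min_elt[lv minv].
have uE := mdeg_class_sum lu; have vE := mdeg_class_sum lv.
move/class_key_lt => lt.
have [E|neq] := eqVneq (class_sum v) (class_sum u).
  rewrite -vE -uE E !ltnn ltxx in lt.
  have {lt}vu : (v < u)%O by case: lt => // -[_ []] // [_ []] // [].
  have dE : mdeg v = mdeg u by rewrite -vE -uE E.
  have /(ltmcP dE)[i eq_i lt_i] := vu.
  case it: (cl i) => [t|]; last by move: lt_i; rewrite lu // lv.
  (* Equal sums over the class of [i] compensate the deficit of [v] at [i] by an excess at some [j];
     it lies after [i], since [u] and [v] agree before [i]. *)
  have [j jt uvj] : exists2 j, cl j = Some t & (u j < v j)%N.
    apply: NNPP => H; have /mnmP/(_ t) := E; rewrite !mnmE.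
    rewrite (bigD1 i) ?it //= [RHS](bigD1 i) ?it //=.
    move=> S; have : (\sum_(i0 | (cl i0 == Some t) && (i0 != i)) v i0 <=
      \sum_(i0 | (cl i0 == Some t) && (i0 != i)) u i0)%N; last first.
      by move=> le; have := leq_add lt_i le; rewrite addSn S ltnn.
    apply: leq_sum => j /andP[/eqP jt _]; rewrite leqNgt; apply/negP => uv.
    by apply: H; exists j.
  have ij : (i < j)%N.
    rewrite ltnNge leq_eqVlt; apply/negP => /orP[/eqP/val_inj ji|/eq_i ji].
      by move: uvj; rewrite ji; lia.
    by move: uvj; rewrite ji ltnn.
  have ui : (0 < u i)%N by apply: leq_trans lt_i.
  have Ui : (U_(i) <= u)%MM by rewrite lep1mP -lt0n.
  (* Replacing x_i by the later parallel x_j keeps the class sums and lowers only the last component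
     of the key. *)
  exists j; split=> //; exists (u - U_(i) + U_(j))%MM.
  have wE : class_sum (u - U_(i) + U_(j))%MM = class_sum u.
    rewrite class_sumD -{2}(submK Ui) class_sumD.
    by rewrite [class_sum U_(j)]class_sumU [class_sum U_(i)]class_sumU it jt.
  have dw : mdeg (u - U_(i) + U_(j))%MM = mdeg u.
    by rewrite -{2}(submK Ui) !mdegD !mdeg1.
  split.
  - by rewrite /lift_pred wE; case/andP: minu.
  - by apply/mnm_lepP=> s; rewrite !mnmDE leq_add2r mnmBE leq_subr.
  apply/class_key_lt; rewrite wE dw; do 3!(right; split=> //).
  apply/(ltmcP dw); exists i => [s si|].
    rewrite mnmDE mnmBE !mnm1E; case: eqP => [E'|_]; first by move: si; rewrite E' ltnn.
    by case: eqP => [E'|_]; [move: si; rewrite -E'; lia|rewrite subn0 addn0].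
  rewrite mnmDE mnmBE !mnm1E eqxx; case: eqP => [E'|_]; last lia.
  by move: ij; rewrite E' ltnn.
have pr : precedes psi (class_sum v) (class_sum u).
  rewrite /precedes vE uE; case: lt => [|[? [|[? [|[E]]]]]]; first by left.
  - by right; split=> //; left.
  - by right; split=> //; right.
  - by move/eqP: neq.
have [t yt [w [Jw wy prw]]] := exJ _ _ minu minv pr.
have [j jt uvj] := class_sum_exists yt (erefl (class_sum v)).
have [|w' [w'u lw w'E]] := @class_sum_lift (u + U_(j))%MM w.
  by rewrite class_sumD class_sumU jt.
exists j; split=> //; exists w'; split=> //; first by rewrite /lift_pred w'E.
by apply: precedes_class_key; rewrite ?w'E // -w'E mdeg_class_sum.
Qed.

End LiftIdeal.

(** * Lifting sums of bases and blocking sets *)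

Section LiftBases.
Variable B : 'X_{1..c} -> Prop.

Definition lift_bases u : Prop := loopfree u /\ B (class_sum u).

(** Upwards, bases are lifted one at a time: after removing a lift of the first, the class sums of
    the remainder still dominate the other k - 1. *)
Lemma lift_sum_of k u :
  above (sum_of lift_bases k) u <-> above (sum_of B k) (class_sum u).
Proof.
split=> [[v kv vu]|[z kz zu]].
  exists (class_sum v); last exact: class_sum_le.
  elim: k v kv {vu} => [|k IHk] v /=; first by move=> ->; apply: class_sum0.
  move=> [b [w [[_ Bb] /IHk kw ->]]]; exists (class_sum b), (class_sum w).
  by split=> //; apply: class_sumD.
elim: k z u kz zu => [|k IHk] z u /=.
  by exists 0%MM => //; apply/mnm_lepP=> i; rewrite mnm0E.
move=> [b [w [Bb kw ->]]] bwu.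
have [|v [vu lv vE]] := @class_sum_lift u b.
  exact: lepm_trans (lem_addr _ _) bwu.
have [|v' kv' v'u] := IHk w (u - v)%MM kw.
  rewrite class_sumB // vE; apply/mnm_lepP=> t; move: (mnm_lepP bwu t).
  by rewrite mnmBE mnmDE; lia.
exists (v + v')%MM; first by exists v, v'; split=> //; split; rewrite ?vE.
apply/mnm_lepP=> i; move: (mnm_lepP v'u i) (mnm_lepP vu i).
by rewrite mnmBE mnmDE; lia.
Qed.

Lemma lift_weight k u :
  (forall A, blocking lift_bases A -> (k <= weight A u)%N) <->
  (forall C, blocking B C -> (k <= weight C (class_sum u))%N).
Proof.
split=> [H C trC | H A trA].
  pose A := [set i | if cl i is Some t then t \in C else false].
  have -> : weight C (class_sum u) = weight A u.
    rewrite /weight; under eq_bigr do rewrite mnmE.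
    rewrite (exchange_big_dep (mem A)) /= => [|t i tC /eqP it]; last first.
      by rewrite inE it.
    apply: eq_bigr => i; rewrite inE; case it: (cl i) => [t|//] tC.
    rewrite (big_pred1 t) // => s; rewrite eq_sym (inj_eq (@Some_inj _)).
    by rewrite andb_idl // => /eqP ->.
  apply: H => g [lg /trC[t tC]] /class_sum_gt0[i it gi].
  by exists i; rewrite // inE it.
(* The classes lying entirely inside [A], empty classes included: any other class offers a
   representative outside [A]. *)
pose C := [set t | [forall i, (cl i == Some t) ==> (i \in A)]].
apply: (@leq_trans (weight C (class_sum u))).
  apply: H => b Bb; apply: NNPP => notC.
  (* A vector zero on [A] and large elsewhere: a basis missing [C] lifts below it, to a lifted basis
     that avoids [A]. *)
  pose u0 : 'X_{1..n} := [multinom (i \notin A) * mdeg b | i < n]%N.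
  have [|g [gu lg gb]] := @class_sum_lift u0 b.
    apply/mnm_lepP=> t; case: (posnP (b t)) => [-> //|bt].
    have tC : t \notin C by apply/negP => tC; apply: notC; exists t.
    move: tC; rewrite inE negb_forall => /existsP[i].
    rewrite negb_imply => /andP[it iA].
    rewrite mnmE (bigD1 i) //= mnmE iA mul1n.
    by apply: leq_trans (leq_addr _ _); rewrite mdegE (bigD1 t) //= leq_addr.
  have [|i iA gi] := trA g; first by split=> //; rewrite gb.
  by have := mnm_lepP gu i; rewrite mnmE iA; lia.
rewrite /weight; under eq_bigr do rewrite mnmE.
rewrite (exchange_big_dep (mem A)) /= => [|t i]; last first.
  by rewrite inE => /forallP/(_ i)/implyP iA it; apply: iA.
apply: leq_sum => i iA; case it: (cl i) => [t|]; last by rewrite big1 // => ? /andP[].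
rewrite big_mkcond (bigD1 t) //= eqxx andbT big1 => [|s st]; first by case: ifP; lia.
by case: eqP => [[E]|_]; [rewrite E eqxx in st|rewrite andbF].
Qed.

End LiftBases.
End ClassMap.

(* The conclusion depends only on the matroid modulo loops and parallel
   classes: [pw k] and [sy k] describe the exponents of the ordinary and the
   symbolic power, [r] is the rank. *)
Definition reg_model c (B : 'X_{1..c} -> Prop) : Prop :=
  exists r : nat, forall k : nat, exists (pw sy : pred 'X_{1..c}),
  [/\ forall y, pw y <-> above (sum_of B k) y,
      forall y, sy y <-> forall C, blocking B C -> (k <= weight C y)%N,
      exists2 psi, exchange psi pw & exists psi', exchange psi' sy,
      forall y, min_elt pw y \/ min_elt sy y -> (mdeg y <= r * k)%N
    & forall b, B b -> [/\ mdeg b = r, min_elt pw (b *+ k)%MM & min_elt sy (b *+ k)%MM]].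

Theorem reg_model_proposition (K : fieldType) (n c : nat)
    (I : {mpoly K[n]} -> Prop) (G : 'X_{1..n} -> Prop)
    (cl : 'I_n -> option 'I_c) (B : 'X_{1..c} -> Prop) :
  (forall f, I f <-> supp_in (above G) f) ->
  (forall b i, G b -> (b i <= 1)%N) -> (exists g, G g) ->
  (forall u, G u <-> lift_bases cl B u) -> reg_model B -> forall k,
  (exists r : int, has_reg (symb_pow I k) r /\ has_reg (ideal_pow I k) r) /\
  linear_quotients (symb_pow I k).
Proof.
move=> IG Gsq [g0 Gg0] GB [r model] k.
have [pw [sy [pwE syE [psi exP [psi' exS]] bnd att]]] := model k.
have upP : upclosed pw by move=> u v uv /pwE Pu; apply/pwE; apply: above_up uv Pu.
have upS : upclosed sy.
  move=> u v uv /syE Su; apply/syE => C /Su; move=> H.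
  exact: leq_trans H (leq_weight C uv).
have above_ext k' u : above (sum_of G k') u <-> above (sum_of (lift_bases cl B) k') u.
  suff E v : sum_of G k' v <-> sum_of (lift_bases cl B) k' v.
    by split=> -[v kv vu]; exists v => //; apply/E.
  elim: k' v => //= k' IH v.
  by split=> -[b [w [/GB Gb /IH kw ->]]]; exists b, w; split=> //; apply/GB.
have IP f : ideal_pow I k f <-> supp_in (lift_pred cl pw) f.
  rewrite (ideal_powE IG); split; apply: supp_inW => m.
    by move/above_ext/lift_sum_of/pwE.
  by move/pwE/lift_sum_of/above_ext.
have IS f : symb_pow I k f <-> supp_in (lift_pred cl sy) f.
  have trE A : blocking G A <-> blocking (lift_bases cl B) A.
    by split=> trA b /GB; apply: trA.
  rewrite (symb_powE IG Gsq); split; apply: supp_inW => m.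
    by move=> H; apply/syE; apply/lift_weight => A /trE; apply: H.
  by move=> /syE/lift_weight H A /trE; apply: H.
have bndP u : min_elt (lift_pred cl pw) u -> (mdeg u <= r * k)%N.
  by move=> /lift_min_elt[lu minu]; rewrite -(mdeg_class_sum lu) bnd //; left.
have bndS u : min_elt (lift_pred cl sy) u -> (mdeg u <= r * k)%N.
  by move=> /lift_min_elt[lu minu]; rewrite -(mdeg_class_sum lu) bnd //; right.
have [lg Bg] : lift_bases cl B g0 by apply/GB.
have [dg minP minS] := att _ Bg.
have lkg : loopfree cl (g0 *+ k)%MM by move=> i /lg gi; rewrite mulmnE gi.
have dk : mdeg (g0 *+ k)%MM = (r * k)%N by rewrite mdegMn -(mdeg_class_sum lg) dg.
have exP' := @lift_exchange _ _ cl _ _ exP.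
have exS' := @lift_exchange _ _ cl _ _ exS.
have attP : exists2 u, min_elt (lift_pred cl pw) u & mdeg u = (r * k)%N.
  by exists (g0 *+ k)%MM => //; apply/lift_min_elt; rewrite class_sumMn.
have attS : exists2 u, min_elt (lift_pred cl sy) u & mdeg u = (r * k)%N.
  by exists (g0 *+ k)%MM => //; apply/lift_min_elt; rewrite class_sumMn.
split; first exists (r * k)%N%:Z; first split.
- exact: (lq_has_reg (lift_pred_up upS) (@class_key_inj _ _ cl psi')
    (@class_key_deg _ _ cl psi') bndS attS exS' IS).
- exact: (lq_has_reg (lift_pred_up upP) (@class_key_inj _ _ cl psi)
    (@class_key_deg _ _ cl psi) bndP attP exP' IP).
exact: (lq_linear_quotients (lift_pred_up upS) (@class_key_inj _ _ cl psi')
    (@class_key_deg _ _ cl psi') bndS exS' IS).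
Qed.

(** * Exponents in four variables *)

(** With a single basis [e] both powers are principal in the class variables, generated by k e, and
    exchange is vacuous. *)
Lemma box_reg_model c (B : 'X_{1..c} -> Prop) (e : 'X_{1..c}) :
  (forall b, B b <-> b = e) -> (forall t, (e t <= 1)%N) -> reg_model B.
Proof.
move=> Be e1; exists (mdeg e) => k; pose box := fun y : 'X_{1..c} => (e *+ k <= y)%MM.
have upbox : upclosed box by move=> u v uv ku; apply: lepm_trans uv.
have minbox y : min_elt box y <-> y = (e *+ k)%MM.
  split=> [/(min_eltP _ upbox)[ky miny]|->].
    by rewrite (miny (e *+ k)%MM) // /box lepm_refl.
  apply/(min_eltP _ upbox); split=> [|v kv vk]; first exact: lepm_refl.
  by apply/mnmP=> t; apply/eqP; rewrite eqn_leq (mnm_lepP vk) (mnm_lepP kv).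
have exbox : exchange (fun=> 0%N) box.
  move=> y z /minbox -> /minbox -> [|[_ [|[_]]]]; by rewrite ?ltnn ?ltxx.
exists box, box; split.
- move=> y; have sum_e l u : sum_of B l u <-> u = (e *+ l)%MM.
    elim: l u => [|l IHl] u; first by rewrite mulm0n.
    split=> [[b [v [/Be -> /IHl -> ->]]]|->]; first by rewrite mulmS.
    by exists e, (e *+ l)%MM; rewrite mulmS; split=> //; [apply/Be|apply/IHl].
  split=> [ky|[u /sum_e -> //]]; exists (e *+ k)%MM => //; exact/sum_e.
- move=> y; split=> [ky C /(_ e)[|t tC et]|H]; first exact/Be.
    rewrite /weight (bigD1 t) //=; apply: leq_trans (leq_addr _ _).
    by apply: leq_trans (mnm_lepP ky t); rewrite mulmnE leq_pmull.
  apply/mnm_lepP=> t; rewrite mulmnE; case: (posnP (e t)) => [->|et].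
    by rewrite mul0n.
  have -> : e t = 1%N by apply/eqP; rewrite eqn_leq e1.
  (* Every element of the only basis is a blocking set by itself. *)
  have := H [set t]; rewrite /weight big_set1 mul1n; apply.
  by move=> b /Be ->; exists t; rewrite ?set11.
- by exists (fun=> 0%N) => //; exists (fun=> 0%N).
- by move=> y [] /minbox ->; rewrite mdegMn.
by move=> b /Be ->; split=> //; apply/minbox.
Qed.

Section FourVariables.

Definition o0 : 'I_4 := @Ordinal 4 0 isT.
Definition o1 : 'I_4 := @Ordinal 4 1 isT.
Definition o2 : 'I_4 := @Ordinal 4 2 isT.
Definition o3 : 'I_4 := @Ordinal 4 3 isT.

Lemma I4_ind (P : 'I_4 -> Prop) : P o0 -> P o1 -> P o2 -> P o3 -> forall t, P t.
Proof.
move=> P0 P1 P2 P3 [[|[|[|[|//]]]] lt];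
  [move: P0|move: P1|move: P2|move: P3]; congr (P _); exact: val_inj.
Qed.

(** Explicit coordinates turn divisibility, minimality and order into linear arithmetic over four
    naturals. *)
Definition mk4 (a b c d : nat) : 'X_{1..4} :=
  [multinom nth 0%N [:: a; b; c; d] i | i < 4].

Lemma mk4E a b c d : (mk4 a b c d o0 = a) * (mk4 a b c d o1 = b) *
  (mk4 a b c d o2 = c) * (mk4 a b c d o3 = d).
Proof. by rewrite !mnmE. Qed.

Lemma mk4_eta (y : 'X_{1..4}) : mk4 (y o0) (y o1) (y o2) (y o3) = y.
Proof. by apply/mnmP; apply: I4_ind; rewrite mk4E. Qed.

Lemma mk4_ind (P : 'X_{1..4} -> Prop) :
  (forall a b c d, P (mk4 a b c d)) -> forall y, P y.
Proof. by move=> H y; rewrite -(mk4_eta y). Qed.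

Lemma mdeg_mk4 a b c d : mdeg (mk4 a b c d) = (a + b + c + d)%N.
Proof. by rewrite mdegE !big_ord_recl big_ord0 !mnmE /= addn0 !addnA. Qed.

Lemma mk4_le a b c d a' b' c' d' : (mk4 a b c d <= mk4 a' b' c' d')%MM =
  [&& a <= a', b <= b', c <= c' & d <= d']%N.
Proof.
apply/mnm_lepP/and4P => [H|[]].
  by have := (H o0, H o1, H o2, H o3); rewrite !mk4E => -[[[]]].
by move=> ? ? ? ?; apply: I4_ind; rewrite !mk4E.
Qed.

Lemma mk4B a b c d a' b' c' d' : (mk4 a b c d - mk4 a' b' c' d')%MM =
  mk4 (a - a') (b - b') (c - c') (d - d').
Proof. by apply/mnmP; apply: I4_ind; rewrite mnmBE !mk4E. Qed.

Lemma mk4D a b c d a' b' c' d' : (mk4 a b c d + mk4 a' b' c' d')%MM =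
  mk4 (a + a') (b + b') (c + c') (d + d').
Proof. by apply/mnmP; apply: I4_ind; rewrite mnmDE !mk4E. Qed.

Lemma mk4Mn a b c d k : (mk4 a b c d *+ k)%MM = mk4 (a * k) (b * k) (c * k) (d * k).
Proof. by apply/mnmP; apply: I4_ind; rewrite mulmnE !mk4E. Qed.

Lemma mk4U : (U_(o0) = mk4 1 0 0 0)%MM * (U_(o1) = mk4 0 1 0 0)%MM *
  (U_(o2) = mk4 0 0 1 0)%MM * (U_(o3) = mk4 0 0 0 1)%MM.
Proof. by do !split; apply/mnmP; apply: I4_ind; rewrite mnm1E mk4E. Qed.

Definition lex4 a b c d a' b' c' d' : bool :=
  (a < a')%N || (a == a') && ((b < b')%N || (b == b') &&
    ((c < c')%N || (c == c') && (d < d')%N)).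

Lemma mk4_lt a b c d a' b' c' d' : (a + b + c + d = a' + b' + c' + d')%N ->
  (mk4 a b c d < mk4 a' b' c' d')%O = lex4 a b c d a' b' c' d'.
Proof.
move=> E; have dE : mdeg (mk4 a b c d) = mdeg (mk4 a' b' c' d') by rewrite !mdeg_mk4.
apply/(ltmcP dE)/idP.
  case; apply: I4_ind => H; have := (H o0, H o1, H o2); rewrite !mk4E /lex4 /=.
  - by move=> _ ->.
  - by move=> [[/(_ isT) -> _] _] ->; rewrite eqxx orbT.
  - by move=> [[/(_ isT) -> /(_ isT) ->] _] ->; rewrite !eqxx !orbT.
  by move=> [[/(_ isT) -> /(_ isT) ->] /(_ isT) ->] ->; rewrite !eqxx !orbT.
have le0 (P : 'I_4 -> Prop) : forall j : 'I_4, (j < o0)%N -> P j by case.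
case/orP=> [lt|/andP[/eqP e0 /orP[lt|/andP[/eqP e1 /orP[lt|/andP[/eqP e2 lt]]]]]].
- by exists o0; rewrite ?mk4E.
- by exists o1; rewrite ?mk4E //; apply: I4_ind; rewrite ?mk4E.
- by exists o2; rewrite ?mk4E //; apply: I4_ind; rewrite ?mk4E.
by exists o3; rewrite ?mk4E //; apply: I4_ind; rewrite ?mk4E.
Qed.

Definition pred4 (P : nat -> nat -> nat -> nat -> bool) : pred 'X_{1..4} :=
  fun y => P (y o0) (y o1) (y o2) (y o3).

Definition min4 (P : nat -> nat -> nat -> nat -> bool) a b c d : bool :=
  [&& P a b c d, (0 < a)%N ==> ~~ P a.-1 b c d, (0 < b)%N ==> ~~ P a b.-1 c d,
      (0 < c)%N ==> ~~ P a b c.-1 d & (0 < d)%N ==> ~~ P a b c d.-1].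

Lemma min_elt_mk4 P a b c d : min_elt (pred4 P) (mk4 a b c d) = min4 P a b c d.
Proof.
rewrite /min_elt /min4 {1}/pred4 !mk4E; congr (_ && _).
apply/forallP/and4P=> [H|[? ? ? ?]].
  by have := (H o0, H o1, H o2, H o3); rewrite !mk4U !mk4B /pred4 !mk4E !subn0 !subn1
    => -[[[]]].
by apply: I4_ind; rewrite !mk4U !mk4B /pred4 !mk4E !subn0 !subn1.
Qed.

Definition precedes4 (psi : nat -> nat -> nat -> nat -> nat)
    a' b' c' d' a b c d : bool :=
  (a' + b' + c' + d' < a + b + c + d)%N ||
  (a' + b' + c' + d' == a + b + c + d)%N &&
  ((psi a' b' c' d' < psi a b c d)%N ||
   (psi a' b' c' d' == psi a b c d)%N && lex4 a' b' c' d' a b c d).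

Definition psi_of (psi : nat -> nat -> nat -> nat -> nat) (y : 'X_{1..4}) : nat :=
  psi (y o0) (y o1) (y o2) (y o3).

Lemma precedes_mk4 psi a' b' c' d' a b c d :
  precedes (psi_of psi) (mk4 a' b' c' d') (mk4 a b c d) <->
  precedes4 psi a' b' c' d' a b c d.
Proof.
rewrite /precedes /precedes4 /psi_of !mdeg_mk4 !mk4E; split.
  case=> [->//|[E]]; rewrite -(mk4_lt E) E eqxx ltnn /=.
  by case=> [->//|[-> ->]]; rewrite eqxx orbT.
case/orP=> [|/andP[/eqP E]]; [by left | right; split=> //].
case/orP: b0 => [|/andP[/eqP E']]; [by left | right; split=> //].
by rewrite (mk4_lt E).
Qed.

Definition exchange4 psi (P : nat -> nat -> nat -> nat -> bool) : Prop :=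
  forall a b c d a' b' c' d', min4 P a b c d -> min4 P a' b' c' d' ->
  precedes4 psi a' b' c' d' a b c d ->
  exists wa wb wc wd, [/\ P wa wb wc wd, precedes4 psi wa wb wc wd a b c d &
   [|| [&& a < a', wa <= a.+1, wb <= b, wc <= c & wd <= d],
       [&& b < b', wa <= a, wb <= b.+1, wc <= c & wd <= d],
       [&& c < c', wa <= a, wb <= b, wc <= c.+1 & wd <= d]
     | [&& d < d', wa <= a, wb <= b, wc <= c & wd <= d.+1]]%N].

Lemma exchange_pred4 psi P : exchange4 psi P -> exchange (psi_of psi) (pred4 P).
Proof.
move=> ex4; apply: mk4_ind => a b c d; apply: mk4_ind => a' b' c' d'.
rewrite !min_elt_mk4 => miny minz /precedes_mk4 pr.
have [wa [wb [wc [wd [Pw prw]]]]] := ex4 _ _ _ _ _ _ _ _ miny minz pr.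
move=> /or4P[] /and5P[lt w1 w2 w3 w4]; [exists o0|exists o1|exists o2|exists o3];
  rewrite ?mk4E //; exists (mk4 wa wb wc wd);
  (split; [by rewrite /pred4 !mk4E | | exact/precedes_mk4]);
  by rewrite !mk4U !mk4D mk4_le !addn0 !addn1 w1 w2 w3 w4.
Qed.

Definition bases4 (Bs : seq (nat * nat * nat * nat)) (b : 'X_{1..4}) : Prop :=
  exists2 q, q \in Bs & let: (a, b', c, d) := q in b = mk4 a b' c d.

(** The recursion for [P] splits off one basis, and a blocking set is given by four booleans; all
    hypotheses then concern natural numbers only. Ordinary powers use the constant tie-breaker. *)
Lemma reg_model4 Bs (r : nat) (P S : nat -> nat -> nat -> nat -> nat -> bool) psi :
  (forall a b c d, P 0%N a b c d) ->
  (forall k a b c d, P k.+1 a b c d =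
    has (fun q => let: (a', b', c', d') := q in
      [&& a' <= a, b' <= b, c' <= c, d' <= d &
          P k (a - a') (b - b') (c - c') (d - d')]%N) Bs) ->
  (forall k a b c d, S k a b c d <-> forall c0 c1 c2 c3 : bool,
    all (fun q => let: (a', b', c', d') := q in
      [|| c0 && (0 < a'), c1 && (0 < b'), c2 && (0 < c') | c3 && (0 < d')]%N) Bs ->
    (k <= c0 * a + c1 * b + c2 * c + c3 * d)%N) ->
  (forall k, exchange4 (fun _ _ _ _ => 0%N) (P k)) ->
  (forall k, exchange4 psi (S k)) ->
  (forall k a b c d, min4 (P k) a b c d -> (a + b + c + d <= r * k)%N) ->
  (forall k a b c d, min4 (S k) a b c d -> (a + b + c + d <= r * k)%N) ->
  (forall k, all (fun q => let: (a, b, c, d) := q in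
     [&& a + b + c + d == r, min4 (P k) (a * k) (b * k) (c * k) (d * k)
       & min4 (S k) (a * k) (b * k) (c * k) (d * k)]%N) Bs) ->
  reg_model (bases4 Bs).
Proof.
move=> P0 PS SE exP exS bndP bndS att; exists r => k.
exists (pred4 (P k)), (pred4 (S k)); split.
- elim: k => [|k IHk]; apply: mk4_ind => a b c d; rewrite {1}/pred4 !mk4E.
    by split=> // _; exists 0%MM => //; apply/mnm_lepP=> i; rewrite mnm0E.
  rewrite PS; split.
    move=> /hasP[[[[a' b'] c'] d'] qB] /and5P[la lb lc ld Pk].
    have /IHk[u ku uy] : pred4 (P k) (mk4 (a - a') (b - b') (c - c') (d - d')).
      by rewrite /pred4 !mk4E.
    exists (mk4 a' b' c' d' + u)%MM.
      by exists (mk4 a' b' c' d'), u; split=> //; exists (a', b', c', d').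
    have le : (mk4 a' b' c' d' <= mk4 a b c d)%MM by rewrite mk4_le la lb lc ld.
    rewrite -(submK le) addmC -mk4B in uy *; apply/mnm_lepP=> t.
    by move: (mnm_lepP uy t); rewrite !mnmDE leq_add2r.
  move=> [_ [_ [v [[[[[a' b'] c'] d'] qB ->] kv ->]]] uy].
  apply/hasP; exists (a', b', c', d') => //.
  have le := lepm_trans (lem_addr _ _) uy.
  move: (le); rewrite mk4_le => /and4P[-> -> -> ->] /=.
  have : pred4 (P k) (mk4 a b c d - mk4 a' b' c' d')%MM.
    apply/IHk; exists v => //; apply/mnm_lepP=> t; move: (mnm_lepP uy t).
    by rewrite mnmBE mnmDE; lia.
  by rewrite mk4B /pred4 !mk4E.
- apply: mk4_ind => a b c d; rewrite {1}/pred4 !mk4E SE.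
  have wE C : weight C (mk4 a b c d) = ((o0 \in C) * a + (o1 \in C) * b +
      (o2 \in C) * c + (o3 \in C) * d)%N.
    rewrite /weight big_mkcond !big_ord_recl big_ord0 /= addn0 !addnA.
    have -> : ord0 = o0 by apply: val_inj.
    have -> : lift o0 ord0 = o1 by apply: val_inj.
    have -> : lift o0 (lift ord0 ord0) = o2 by apply: val_inj.
    have -> : lift o0 (lift ord0 (lift ord0 ord0)) = o3 by apply: val_inj.
    by rewrite !mk4E; do 4!case: (_ \in C); rewrite ?mul1n ?mul0n.
  split=> [H C blC | H c0 c1 c2 c3 /allP al].
    rewrite wE; apply: H; apply/allP=> -[[[a' b'] c'] d'] qB.
    have [|t] := blC (mk4 a' b' c' d'); first by exists (a', b', c', d').
    by elim/I4_ind: t; rewrite mk4E => -> ->; rewrite ?orbT.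
  pose C := [set t : 'I_4 | nth false [:: c0; c1; c2; c3] t].
  have := H C; rewrite wE !inE; apply => _ [[[[a' b'] c'] d'] /al qB ->].
  case/or4P: qB => /andP[cC gt]; [exists o0|exists o1|exists o2|exists o3];
    by rewrite ?inE ?mk4E.
- exists (psi_of (fun _ _ _ _ => 0%N)); first exact: exchange_pred4.
  by exists (psi_of psi); apply: exchange_pred4.
- apply: mk4_ind => a b c d; rewrite !min_elt_mk4 mdeg_mk4.
  by case=> [/bndP|/bndS].
move=> _ [[[[a b] c] d] qB ->]; have /allP/(_ _ qB)/and3P[/eqP dE mP mS] := att k.
by rewrite mk4Mn !min_elt_mk4 mdeg_mk4.
Qed.

End FourVariables.

(** * The uniform matroids *)

Section UniformModels.
Local Open Scope nat_scope.

(* The rank two uniform matroid on three elements, with a coloop if e. *)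
Section U23.
Variable e : bool.

Definition U23_bases := [:: (1, 1, 0, e : nat); (1, 0, 1, e : nat); (0, 1, 1, e : nat)].

Definition U23_sym k a b c d :=
  [&& k <= a + b, k <= a + c, k <= b + c & e * k <= d].

Definition U23_pow k a b c d := U23_sym k a b c d && (2 * k <= a + b + c).

Lemma U23_pow_min k a b c d : min4 (U23_pow k) a b c d ->
  [&& a <= k, b <= k, c <= k, a + b + c == 2 * k & d == e * k].
Proof. rewrite /min4 /U23_pow /U23_sym; case: e; lia. Qed.

(** The basis on the two largest of a, b, c can always be removed; the comparisons determine which
    two these are. *)
Lemma U23_powS k a b c d : U23_pow k.+1 a b c d =
  has (fun q => let: (a', b', c', d') := q in
      [&& a' <= a, b' <= b, c' <= c, d' <= d &
          U23_pow k (a - a') (b - b') (c - c') (d - d')]) U23_bases.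
Proof.
rewrite /= /U23_pow /U23_sym; have -> : e * k.+1 = e + e * k by rewrite mulnS.
move: (e : nat) => e'; move: (e' * k) => ek.
apply/idP/idP => [H|].
  case: (leqP a b) => ab; case: (leqP a c) => ac; case: (leqP b c) => bc;
  do [by apply/orP; left; lia | by apply/orP; right; apply/orP; left; lia
     | by apply/orP; right; apply/orP; right; lia].
by case/orP => [|/orP[|]]; lia.
Qed.

Lemma U23_symE k a b c d : U23_sym k a b c d <-> forall c0 c1 c2 c3 : bool,
  all (fun q => let: (a', b', c', d') := q in
    [|| c0 && (0 < a'), c1 && (0 < b'), c2 && (0 < c') | c3 && (0 < d')])
    U23_bases ->
  k <= c0 * a + c1 * b + c2 * c + c3 * d.
Proof.
rewrite /U23_sym /=; split.
  by case: e => /= H c0 c1 c2 c3; case: c0 c1 c2 c3 => [] [] [] [] //= _; lia.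
(* The minimal blocking sets are the three pairs of the triangle and, if [e] holds, the coloop. *)
move=> H; have := H true true false false; have := H true false true false.
have := H false true true false; have := H false false false true.
by case: e => /=; lia.
Qed.

Lemma U23_pow_exchange k : exchange4 (fun _ _ _ _ => 0) (U23_pow k).
Proof.
move=> a b c d a' b' c' d' /U23_pow_min miny /U23_pow_min minz.
rewrite /precedes4 /lex4 => pr.
(* Degrees agree, so a predecessor is smaller in some coordinate and larger in a later one; a unit
   is moved from the former to the latter. *)
have [lt|[lt|lt]] : a' < a /\ b < b' \/ a' < a /\ c < c' \/ b' < b /\ c < c' by lia.
- by exists a.-1, b.+1, c, d; rewrite /U23_pow /U23_sym; split; lia.
- by exists a.-1, b, c.+1, d; rewrite /U23_pow /U23_sym; split; lia.
by exists a, b.-1, c.+1, d; rewrite /U23_pow /U23_sym; split; lia.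
Qed.

(** Minimality forces both larger coordinates to complement the smallest one, m, to k. Apart from
    the coloop the degree is 2k - m, so a larger minimum means a smaller degree. *)
Lemma U23_sym_min k a b c d : min4 (U23_sym k) a b c d -> d = e * k /\
  [\/ [/\ b = k - a, c = k - a & 2 * a <= k], [/\ a = k - b, c = k - b & 2 * b <= k]
    | [/\ a = k - c, b = k - c & 2 * c <= k]].
Proof.
rewrite /min4 /U23_sym; move: (e * k) => ek.
move=> /and5P[/and4P[ab ac bc ed] Ha Hb Hc Hd].
have dE : d = ek by clear Ha Hb Hc; lia.
split=> //; rewrite ed !andbT in Ha Hb Hc; clear Hd dE ed.
have [[le1 le2]|[le1 le2]|[le1 le2]] : [\/ a <= b /\ a <= c,
    b <= a /\ b <= c | c <= a /\ c <= b].
- clear Ha Hb Hc ab ac bc; case: (leqP a b) => ?; case: (leqP a c) => ?;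
  case: (leqP b c) => ?; do [by constructor 1; lia | by constructor 2; lia
    | by constructor 3; lia].
- have bE : b = k - a by clear Ha Hc; lia.
  have cE : c = k - a by clear Ha Hb; lia.
  by constructor 1; split=> //; clear Hb Hc; lia.
- have aE : a = k - b by clear Hb Hc; lia.
  have cE : c = k - b by clear Ha Hb; lia.
  by constructor 2; split=> //; clear Ha Hc; lia.
have aE : a = k - c by clear Hb Hc; lia.
have bE : b = k - c by clear Ha Hc; lia.
by constructor 3; split=> //; clear Ha Hb; lia.
Qed.

(** While the smallest coordinate m satisfies 2(m + 1) <= k, raising it by one and lowering the two
    others by one reaches a smaller degree. *)
Lemma U23_sym_exchange k : exchange4 (fun _ _ _ _ => 0) (U23_sym k).
Proof.
move=> a b c d a' b' c' d' /U23_sym_min[dE Y] /U23_sym_min[dE' Z].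
rewrite /precedes4 /lex4 /U23_sym -dE; rewrite -dE in dE'.
move: d dE d' dE' => d _ _ -> pr.
case: Y => -[E1 E2 E3].
- have [lt|lt] := leqP (2 * a.+1) k.
    exists a.+1, (k - a.+1), (k - a.+1), d; split; try lia.
    by case: Z => -[]; lia.
  (* Now the degree of y is least possible, so z rearranges y; it exceeds y by one in the coordinate
     a and is itself the witness. *)
  by exists a', b', c', d; split=> //; case: Z => -[]; lia.
- have [lt|lt] := leqP (2 * b.+1) k.
    exists (k - b.+1), b.+1, (k - b.+1), d; split; try lia.
    by case: Z => -[]; lia.
  by exists a', b', c', d; split=> //; case: Z => -[]; lia.
have [lt|lt] := leqP (2 * c.+1) k.
  exists (k - c.+1), (k - c.+1), c.+1, d; split; try lia.
  by case: Z => -[]; lia.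
by exists a', b', c', d; split=> //; case: Z => -[]; lia.
Qed.

Lemma U23_reg_model : reg_model (bases4 U23_bases).
Proof.
apply: (@reg_model4 _ (2 + e) U23_pow U23_sym (fun _ _ _ _ => 0)).
- by rewrite /U23_pow /U23_sym; case: e; lia.
- exact: U23_powS.
- exact: U23_symE.
- exact: U23_pow_exchange.
- exact: U23_sym_exchange.
- by move=> k a b c d /U23_pow_min; case: e => /=; lia.
- by move=> k a b c d /U23_sym_min[-> []] []; case: e => /=; lia.
move=> k; rewrite /= !mul1n !mul0n /min4 /U23_pow /U23_sym; move: (e : nat) => e'.
move: (e' * k) => ek; rewrite !andbT.
by do !(apply/andP; split); lia.
Qed.

End U23.

(** Where z first differs from y it is smaller, so a later coordinate is larger in z. A unit moved
    there respects the cap, since the raised coordinate stays at most that of z. *)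
Lemma capped_exchange k s (P : nat -> nat -> nat -> nat -> bool) :
  (forall a b c d, [&& a <= k, b <= k, c <= k, d <= k & a + b + c + d == s] ->
    P a b c d) ->
  (forall a b c d, min4 P a b c d ->
    [&& a <= k, b <= k, c <= k, d <= k & a + b + c + d == s]) ->
  exchange4 (fun _ _ _ _ => 0) P.
Proof.
move=> sP Ps a b c d a' b' c' d'.
move=> /Ps/and5P[ak bk ck dk /eqP sE] /Ps/and5P[ak' bk' ck' dk' /eqP sE'].
rewrite /precedes4 sE sE' !ltnn eqxx /= => /orP[lt|/andP[/eqP Ea]].
  have : [|| b < b', c < c' | d < d'] by lia.
  case/or3P => lt'; [exists a.-1, b.+1, c, d|exists a.-1, b, c.+1, d|
    exists a.-1, b, c, d.+1]; (split; [apply: sP; lia| |lia]);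
    by rewrite /precedes4 /lex4 !ltnn; lia.
case/orP=> [lt|/andP[/eqP Eb /orP[lt|/andP[/eqP Ec lt]]]]; last by lia.
  have /orP[lt'|lt'] : (c < c') || (d < d') by lia.
    by exists a, b.-1, c.+1, d; split; [apply: sP; lia| |]; rewrite /precedes4 /lex4; lia.
  by exists a, b.-1, c, d.+1; split; [apply: sP; lia| |]; rewrite /precedes4 /lex4; lia.
by exists a, b, c.-1, d.+1; split; [apply: sP; lia| |]; rewrite /precedes4 /lex4; lia.
Qed.

(** * The uniform matroid of rank three on four elements *)

Definition U34_bases := [:: (1, 1, 1, 0); (1, 1, 0, 1); (1, 0, 1, 1); (0, 1, 1, 1)].

Definition U34_sym k a b c d :=
  [&& k <= a + b, k <= a + c, k <= a + d, k <= b + c, k <= b + d & k <= c + d].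

Definition U34_pow k a b c d :=
  [&& U34_sym k a b c d, 2 * k <= a + b + c, 2 * k <= a + b + d,
      2 * k <= a + c + d, 2 * k <= b + c + d & 3 * k <= a + b + c + d].

Lemma U34_pow_min k a b c d : min4 (U34_pow k) a b c d ->
  [&& a <= k, b <= k, c <= k, d <= k & a + b + c + d == 3 * k].
Proof.
rewrite /min4 /U34_pow /U34_sym => /and5P[H Ha Hb Hc Hd].
have ak : a <= k by clear Hb Hc Hd; lia.
have bk : b <= k by clear Ha Hc Hd; lia.
have ck : c <= k by clear Ha Hb Hd; lia.
have dk : d <= k by clear Ha Hb Hc; lia.
by clear Hb Hc Hd; lia.
Qed.

(** The basis omitting a smallest coordinate can always be removed. *)
Lemma U34_powS k a b c d : U34_pow k.+1 a b c d =
  has (fun q => let: (a', b', c', d') := q in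
      [&& a' <= a, b' <= b, c' <= c, d' <= d &
          U34_pow k (a - a') (b - b') (c - c') (d - d')]) U34_bases.
Proof.
rewrite /= /U34_pow /U34_sym.
apply/idP/idP => [H|].
  have : [|| [&& a <= b, a <= c & a <= d], [&& b <= a, b <= c & b <= d],
    [&& c <= a, c <= b & c <= d] | [&& d <= a, d <= b & d <= c]].
    by clear H; lia.
  case/or4P => lt; [do 3!(apply/orP; right)|do 2!(apply/orP; right)|
    apply/orP; right|]; apply/orP; left; lia.
by case/or4P => [| | |/orP[|//]]; lia.
Qed.

Lemma U34_symE k a b c d : U34_sym k a b c d <-> forall c0 c1 c2 c3 : bool,
  all (fun q => let: (a', b', c', d') := q in
    [|| c0 && (0 < a'), c1 && (0 < b'), c2 && (0 < c') | c3 && (0 < d')])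
    U34_bases ->
  k <= c0 * a + c1 * b + c2 * c + c3 * d.
Proof.
rewrite /U34_sym /=; split.
  by move=> H c0 c1 c2 c3; case: c0 c1 c2 c3 => [] [] [] [] //= _; lia.
move=> H; have := H true true false false; have := H true false true false.
have := H true false false true; have := H false true true false.
by have := H false true false true; have := H false false true true; rewrite /=; lia.
Qed.

Lemma U34_pow_exchange k : exchange4 (fun _ _ _ _ => 0) (U34_pow k).
Proof.
apply: (@capped_exchange k (3 * k)) => [|a b c d /U34_pow_min //].
by rewrite /U34_pow /U34_sym => a b c d /and5P[]; lia.
Qed.

Lemma U34_sym_min k a b c d : min4 (U34_sym k) a b c d ->
  [\/ [/\ b = k - a, c = k - a, d = k - a & 2 * a <= k],
      [/\ a = k - b, c = k - b, d = k - b & 2 * b <= k],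
      [/\ a = k - c, b = k - c, d = k - c & 2 * c <= k]
    | [/\ a = k - d, b = k - d, c = k - d & 2 * d <= k]].
Proof.
rewrite /min4 /U34_sym => /and5P[H Ha Hb Hc Hd].
have : [|| [&& a <= b, a <= c & a <= d], [&& b <= a, b <= c & b <= d],
    [&& c <= a, c <= b & c <= d] | [&& d <= a, d <= b & d <= c]].
  by clear H Ha Hb Hc Hd; lia.
case/or4P => /and3P[le1 le2 le3].
- have bE : b = k - a by clear Ha Hc Hd; lia.
  have cE : c = k - a by clear Ha Hb Hd; lia.
  have dE : d = k - a by clear Ha Hb Hc; lia.
  by constructor 1; split=> //; clear Hb Hc Hd; lia.
- have aE : a = k - b by clear Hb Hc Hd; lia.
  have cE : c = k - b by clear Ha Hb Hd; lia.
  have dE : d = k - b by clear Ha Hb Hc; lia.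
  by constructor 2; split=> //; clear Ha Hc Hd; lia.
- have aE : a = k - c by clear Hb Hc Hd; lia.
  have bE : b = k - c by clear Ha Hc Hd; lia.
  have dE : d = k - c by clear Ha Hb Hc; lia.
  by constructor 3; split=> //; clear Ha Hb Hd; lia.
have aE : a = k - d by clear Hb Hc Hd; lia.
have bE : b = k - d by clear Ha Hc Hd; lia.
have cE : c = k - d by clear Ha Hb Hd; lia.
by constructor 4; split=> //; clear Ha Hb Hc; lia.
Qed.

(** Generators consist of a minimum m and three copies of k - m, of degree 3k - 2m; raising m lowers
    the degree until 2(m + 1) > k, where all predecessors are rearrangements. *)
Lemma U34_sym_exchange k : exchange4 (fun _ _ _ _ => 0) (U34_sym k).
Proof.
move=> a b c d a' b' c' d' /U34_sym_min Y /U34_sym_min Z.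
rewrite /precedes4 /lex4 /U34_sym => pr.
case: Y => -[E1 E2 E3 E4].
- have [lt|lt] := leqP (2 * a.+1) k.
    exists a.+1, (k - a.+1), (k - a.+1), (k - a.+1); split; try lia.
    by case: Z => -[]; lia.
  by exists a', b', c', d'; split=> //; [|apply/or4P; constructor 1];
    case: Z => -[]; lia.
- have [lt|lt] := leqP (2 * b.+1) k.
    exists (k - b.+1), b.+1, (k - b.+1), (k - b.+1); split; try lia.
    by case: Z => -[]; lia.
  by exists a', b', c', d'; split=> //; [|apply/or4P; constructor 2];
    case: Z => -[]; lia.
- have [lt|lt] := leqP (2 * c.+1) k.
    exists (k - c.+1), (k - c.+1), c.+1, (k - c.+1); split; try lia.
    by case: Z => -[]; lia.
  by exists a', b', c', d'; split=> //; [|apply/or4P; constructor 3];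
    case: Z => -[]; lia.
have [lt|lt] := leqP (2 * d.+1) k.
  exists (k - d.+1), (k - d.+1), (k - d.+1), d.+1; split; try lia.
  by case: Z => -[]; lia.
by exists a', b', c', d'; split=> //; [|apply/or4P; constructor 4];
    case: Z => -[]; lia.
Qed.

Lemma U34_reg_model : reg_model (bases4 U34_bases).
Proof.
apply: (@reg_model4 _ 3 U34_pow U34_sym (fun _ _ _ _ => 0)).
- by rewrite /U34_pow /U34_sym; lia.
- exact: U34_powS.
- exact: U34_symE.
- exact: U34_pow_exchange.
- exact: U34_sym_exchange.
- by move=> k a b c d /U34_pow_min; lia.
- by move=> k a b c d /U34_sym_min[] []; lia.
move=> k; rewrite /= !mul1n !mul0n /min4 /U34_pow /U34_sym !andbT.
by do !(apply/andP; split); lia.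
Qed.

(** * The uniform matroid of rank two on four elements *)

Definition U24_bases := [:: (1, 1, 0, 0); (1, 0, 1, 0); (1, 0, 0, 1);
  (0, 1, 1, 0); (0, 1, 0, 1); (0, 0, 1, 1)].

Definition U24_sym k a b c d :=
  [&& k <= a + b + c, k <= a + b + d, k <= a + c + d & k <= b + c + d].

Definition U24_pow k a b c d := U24_sym k a b c d && (2 * k <= a + b + c + d).

Lemma U24_pow_min k a b c d : min4 (U24_pow k) a b c d ->
  [&& a <= k, b <= k, c <= k, d <= k & a + b + c + d == 2 * k].
Proof.
rewrite /min4 /U24_pow /U24_sym => /and5P[H Ha Hb Hc Hd].
have ak : a <= k by clear Hb Hc Hd; lia.
have bk : b <= k by clear Ha Hc Hd; lia.
have ck : c <= k by clear Ha Hb Hd; lia.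
have dk : d <= k by clear Ha Hb Hc; lia.
have [a0|a0] := posnP a; last by clear Hb Hc Hd; lia.
have [b0|b0] := posnP b; last by clear Ha Hc Hd; lia.
by clear Ha Hb Hd; lia.
Qed.

Lemma top_pair a b c d :
  [|| [&& a <= c, a <= d, b <= c & b <= d], [&& a <= b, a <= d, c <= b & c <= d],
      [&& a <= b, a <= c, d <= b & d <= c], [&& b <= a, b <= d, c <= a & c <= d],
      [&& b <= a, b <= c, d <= a & d <= c] | [&& c <= a, c <= b, d <= a & d <= b]].
Proof. lia. Qed.

(** The basis on two largest coordinates, located by [top_pair], can always be removed. *)
Lemma U24_powS k a b c d : U24_pow k.+1 a b c d =
  has (fun q => let: (a', b', c', d') := q in
      [&& a' <= a, b' <= b, c' <= c, d' <= d &
          U24_pow k (a - a') (b - b') (c - c') (d - d')]) U24_bases.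
Proof.
rewrite /= /U24_pow /U24_sym.
apply/idP/idP => [H|].
  have := top_pair a b c d.
  move=> /orP[|/orP[|/orP[|/orP[|/orP[|]]]]] lt.
  - by do 5!(apply/orP; right); apply/orP; left; lia.
  - by do 4!(apply/orP; right); apply/orP; left; lia.
  - by do 3!(apply/orP; right); apply/orP; left; lia.
  - by do 2!(apply/orP; right); apply/orP; left; lia.
  - by apply/orP; right; apply/orP; left; lia.
  by apply/orP; left; lia.
by move=> /orP[|/orP[|/orP[|/orP[|/orP[|/orP[|//]]]]]]; lia.
Qed.

Lemma U24_symE k a b c d : U24_sym k a b c d <-> forall c0 c1 c2 c3 : bool,
  all (fun q => let: (a', b', c', d') := q in
    [|| c0 && (0 < a'), c1 && (0 < b'), c2 && (0 < c') | c3 && (0 < d')])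
    U24_bases ->
  k <= c0 * a + c1 * b + c2 * c + c3 * d.
Proof.
rewrite /U24_sym /=; split.
  by move=> H c0 c1 c2 c3; case: c0 c1 c2 c3 => [] [] [] [] //= _; lia.
move=> H; have := H true true true false; have := H true true false true.
by have := H true false true true; have := H false true true true; rewrite /=; lia.
Qed.

Lemma U24_pow_exchange k : exchange4 (fun _ _ _ _ => 0) (U24_pow k).
Proof.
apply: (@capped_exchange k (2 * k)) => [|a b c d /U24_pow_min //].
by rewrite /U24_pow /U24_sym => a b c d /and5P[]; lia.
Qed.

(** If a > 0, minimality gives a triple through the largest coordinate [a] with sum k. As b + c + d
    is the smallest triple sum and at least k, it is k too, so the coordinate omitted by the tight
    triple equals [a]. *)
Lemma U24_sym_max k a b c d : min4 (U24_sym k) a b c d ->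
  [&& b <= a, c <= a & d <= a] ->
  b + c + d = k /\ [\/ b = a, c = a | d = a].
Proof.
rewrite /min4 /U24_sym => /and5P[H Ha _ _ _] max_a.
have E : b + c + d = k by lia.
split=> //; have : [|| b == a, c == a | d == a] by lia.
by case/or3P => /eqP; [constructor 1|constructor 2|constructor 3].
Qed.

(** The transpositions that bring any coordinate to the front, so that [U24_sym_max] applies to
    whichever is largest. *)
Lemma U24_sym_minC k a b c d : min4 (U24_sym k) a b c d ->
  [/\ min4 (U24_sym k) b a c d, min4 (U24_sym k) c b a d & min4 (U24_sym k) d b c a].
Proof.
rewrite /min4 /U24_sym => /and5P[H Ha Hb Hc Hd].
by split; apply/and5P; split; clear - H Ha Hb Hc Hd; lia.
Qed.

(* p and q are the two largest coordinates of a generator of degree k + p. *)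
Definition top2 k p q r t := [&& q == p, r <= p, t <= p & p + r + t == k].

Lemma U24_sym_min k a b c d : min4 (U24_sym k) a b c d ->
  [|| top2 k a b c d, top2 k a c b d, top2 k a d b c,
      top2 k b c a d, top2 k b d a c | top2 k c d a b].
Proof.
move=> miny; have [minb minc mind] := U24_sym_minC miny.
have : [|| [&& b <= a, c <= a & d <= a], [&& a <= b, c <= b & d <= b],
    [&& b <= c, a <= c & d <= c] | [&& b <= d, c <= d & a <= d]].
  by clear; lia.
case/or4P => le.
- have [E [F|F|F]] := U24_sym_max miny le.
  + have -> : top2 k a b c d by rewrite /top2; clear - le E F; lia.
    by rewrite ?orbT.
  + have -> : top2 k a c b d by rewrite /top2; clear - le E F; lia.
    by rewrite ?orbT.
  + have -> : top2 k a d b c by rewrite /top2; clear - le E F; lia.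
    by rewrite ?orbT.
- have [E [F|F|F]] := U24_sym_max minb le.
  + have -> : top2 k a b c d by rewrite /top2; clear - le E F; lia.
    by rewrite ?orbT.
  + have -> : top2 k b c a d by rewrite /top2; clear - le E F; lia.
    by rewrite ?orbT.
  + have -> : top2 k b d a c by rewrite /top2; clear - le E F; lia.
    by rewrite ?orbT.
- have [E [F|F|F]] := U24_sym_max minc le.
  + have -> : top2 k b c a d by rewrite /top2; clear - le E F; lia.
    by rewrite ?orbT.
  + have -> : top2 k a c b d by rewrite /top2; clear - le E F; lia.
    by rewrite ?orbT.
  + have -> : top2 k c d a b by rewrite /top2; clear - le E F; lia.
    by rewrite ?orbT.
- have [E [F|F|F]] := U24_sym_max mind le.
  + have -> : top2 k b d a c by rewrite /top2; clear - le E F; lia.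
    by rewrite ?orbT.
  + have -> : top2 k c d a b by rewrite /top2; clear - le E F; lia.
    by rewrite ?orbT.
  + have -> : top2 k a d b c by rewrite /top2; clear - le E F; lia.
    by rewrite ?orbT.
Qed.

(* How a generator z of smaller or equal degree compares with a generator
   (p, p, r, t): either some coordinate can be raised while the degree drops
   (first two cases) or while the minimum grows (next two), or z itself exceeds
   (p, p, r, t) by one in a single coordinate, or z permutes it. *)
Lemma top2_compare k p q r t N zp zq zr zt : top2 k p q r t ->
  [&& zp <= N, zq <= N, zr <= N, zt <= N & zp + zq + zr + zt == k + N] ->
  N <= p -> ~~ [&& zp == p, zq == q, zr == r & zt == t] ->
  [\/ [|| [&& r < zr, r.+1 < p & t < p] | [&& t < zt, t.+1 < p & r < p]],
      [|| [&& t < zt, t.+1 < p & r == p] | [&& r < zr, r.+1 < p & t == p]],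
      [|| [&& zp <= p, zq <= q, zr == r.+1 & zt <= t]
        | [&& zp <= p, zq <= q, zr <= r & zt == t.+1]]
    | [&& r.+1 == p, t == r, zr == p & zt == p]].
Proof.
rewrite /top2 => /and4P[/eqP -> rp tp /eqP <-] H Np neq.
have [rp'|rp'] := eqVneq r p.
  have : t < p by clear - H Np neq rp'; lia.
  have : t < zt by clear - H Np neq rp' tp; lia.
  case: (ltnP t.+1 p) => lt1 lt2 lt3; [constructor 2|constructor 3];
    by clear neq; lia.
have [tp'|tp'] := eqVneq t p.
  have : r < zr by clear - H Np neq tp' rp rp'; lia.
  case: (ltnP r.+1 p) => lt1 lt2; [constructor 2|constructor 3];
    by clear neq; lia.
have : (r < zr) || (t < zt) by clear - H Np neq rp tp; lia.
clear neq.
case: (ltnP r zr) => ltr; case: (ltnP t zt) => ltt //= _.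
- case: (ltnP r.+1 p) => lt1; first by constructor 1; lia.
  case: (ltnP t.+1 p) => lt2; first by constructor 1; lia.
  by constructor 4; lia.
- by case: (ltnP r.+1 p) => lt1; [constructor 1|constructor 3]; lia.
by case: (ltnP t.+1 p) => lt1; [constructor 1|constructor 3]; lia.
Qed.

(* Ties in degree are broken by the larger minimum. The lexicographic order alone
   fails for k = 6: (0,3,3,3) would follow (2,2,2,2) immediately, with colon
   ideal (x_0^2). *)
Definition spread a b c d := a + b + c + d - minn (minn a b) (minn c d).

(** In equal degree a predecessor has at least as large a minimum; the reverse bound forces equal
    minima, leaving the lexicographic order to decide. *)
Lemma precedes_spread_tie m a' b' c' d' a b c d :
  precedes4 spread a' b' c' d' a b c d -> a' + b' + c' + d' = a + b + c + d ->
  minn (minn a b) (minn c d) = m -> minn (minn a' b') (minn c' d') <= m ->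
  [&& m <= a', m <= b', m <= c', m <= d' & lex4 a' b' c' d' a b c d].
Proof.
rewrite /precedes4 /spread => pr E; move: pr; rewrite -E ltnn eqxx /= => pr my mz.
have ms : m <= a' + b' + c' + d' by rewrite E -my; clear; lia.
rewrite my in pr; move: mz ms pr.
have : [&& minn (minn a' b') (minn c' d') <= a', minn (minn a' b') (minn c' d') <= b',
  minn (minn a' b') (minn c' d') <= c' & minn (minn a' b') (minn c' d') <= d'].
  by clear; lia.
by move: (minn _ (minn c' d')) => mz H mzm ms; clear my; lia.
Qed.

Lemma lex_precedes_spread a' b' c' d' a b c d :
  a' + b' + c' + d' = a + b + c + d ->
  minn (minn a' b') (minn c' d') = minn (minn a b) (minn c d) ->
  lex4 a' b' c' d' a b c d -> precedes4 spread a' b' c' d' a b c d.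
Proof. by rewrite /precedes4 /spread => -> -> ->; rewrite !eqxx !orbT. Qed.

Tactic Notation "raise" integer(i) constr(a) constr(b) constr(c) constr(d) :=
  exists a, b, c, d; split;
    [ rewrite /U24_sym | rewrite /precedes4 /lex4 /spread | apply/or4P; constructor i ];
    lia.

Lemma U24_sym_exchange k : exchange4 spread (U24_sym k).
Proof.
move=> a b c d a' b' c' d' miny minz pr.
have Sz : U24_sym k a' b' c' d' by case/and5P: minz.
(* [N] is the largest coordinate of z; a generator with maximum N has degree k + N. *)
have [N [Nz EN]] : exists N,
    [&& a' <= N, b' <= N, c' <= N & d' <= N] /\ a' + b' + c' + d' = k + N.
  have := U24_sym_min minz; rewrite /top2.
  move=> /orP[|/orP[|/orP[|/orP[|/orP[|]]]]] H; clear - H;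
  do [by exists a'; lia|by exists b'; lia|by exists c'; lia].
have deg : a' + b' + c' + d' <= a + b + c + d.
  by clear - pr; move: pr; rewrite /precedes4; lia.
have neq : ~~ [&& a' == a, b' == b, c' == c & d' == d].
  apply/negP => /and4P[/eqP E1 /eqP E2 /eqP E3 /eqP E4]; move: pr.
  by rewrite E1 E2 E3 E4 /precedes4 /lex4 !ltnn !andbF.
have := U24_sym_min miny; clear miny minz.
(* Six positions of the two largest coordinates, treated alike through [top2_compare] up to its
   permutation case, where the lexicographic order breaks the symmetry. *)
move=> /orP[|/orP[|/orP[|/orP[|/orP[|]]]]] conf.
- have Hz : [&& a' <= N, b' <= N, c' <= N, d' <= N & a' + b' + c' + d' == k + N].
    by clear - Nz EN; lia.
  have Np : N <= a by clear - EN deg conf; move: conf; rewrite /top2; lia.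
  have neq' : ~~ [&& a' == a, b' == b, c' == c & d' == d].
    by clear - neq; lia.
  case: (top2_compare conf Hz Np neq') => [/orP[]|/orP[]|/orP[]|] H;
    move: conf => /and4P[/eqP E1 le1 le2 /eqP E2].
  + by clear - H E1 le1 le2 E2; raise 3 (a.-1) (b.-1) (c.+1) (d).
  + by clear - H E1 le1 le2 E2; raise 4 (a.-1) (b.-1) (c) (d.+1).
  + by clear - H E1 le1 le2 E2; raise 4 (a.-1) (b) (c) (d.+1).
  + by clear - H E1 le1 le2 E2; raise 3 (a.-1) (b) (c.+1) (d).
  + by exists a', b', c', d'; split=> //; apply/or4P; constructor 3; clear - H E1; lia.
  + by exists a', b', c', d'; split=> //; apply/or4P; constructor 4; clear - H E1; lia.
  have sE : a' + b' + c' + d' = a + b + c + d by clear - H E1 le1 le2 E2 EN Nz Np; lia.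
  have my : minn (minn a b) (minn c d) = c by clear - H E1; lia.
  have mz : minn (minn a' b') (minn c' d') <= c by clear - H E1 sE; lia.
  have := precedes_spread_tie pr sE my mz; rewrite /lex4 => tie.
  (* Two coordinates equal p and two equal p - 1; moving a unit from the first coordinate to a later
     smaller one permutes y and lowers it lexicographically. *)
  exists (a.-1), (b), (c.+1), (d); split; first by rewrite /U24_sym; clear - H E1 E2; lia.
    by apply: lex_precedes_spread; rewrite /lex4 ?my; clear - H E1; lia.
  by apply/or4P; constructor 3; clear - H E1; lia.
- have Hz : [&& a' <= N, c' <= N, b' <= N, d' <= N & a' + c' + b' + d' == k + N].
    by clear - Nz EN; lia.
  have Np : N <= a by clear - EN deg conf; move: conf; rewrite /top2; lia.
  have neq' : ~~ [&& a' == a, c' == c, b' == b & d' == d].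
    by clear - neq; lia.
  case: (top2_compare conf Hz Np neq') => [/orP[]|/orP[]|/orP[]|] H;
    move: conf => /and4P[/eqP E1 le1 le2 /eqP E2].
  + by clear - H E1 le1 le2 E2; raise 2 (a.-1) (b.+1) (c.-1) (d).
  + by clear - H E1 le1 le2 E2; raise 4 (a.-1) (b) (c.-1) (d.+1).
  + by clear - H E1 le1 le2 E2; raise 4 (a.-1) (b) (c) (d.+1).
  + by clear - H E1 le1 le2 E2; raise 2 (a.-1) (b.+1) (c) (d).
  + by exists a', b', c', d'; split=> //; apply/or4P; constructor 2; clear - H E1; lia.
  + by exists a', b', c', d'; split=> //; apply/or4P; constructor 4; clear - H E1; lia.
  have sE : a' + b' + c' + d' = a + b + c + d by clear - H E1 le1 le2 E2 EN Nz Np; lia.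
  have my : minn (minn a b) (minn c d) = b by clear - H E1; lia.
  have mz : minn (minn a' b') (minn c' d') <= b by clear - H E1 sE; lia.
  have := precedes_spread_tie pr sE my mz; rewrite /lex4 => tie.
  exists (a.-1), (b.+1), (c), (d); split; first by rewrite /U24_sym; clear - H E1 E2; lia.
    by apply: lex_precedes_spread; rewrite /lex4 ?my; clear - H E1; lia.
  by apply/or4P; constructor 2; clear - H E1; lia.
- have Hz : [&& a' <= N, d' <= N, b' <= N, c' <= N & a' + d' + b' + c' == k + N].
    by clear - Nz EN; lia.
  have Np : N <= a by clear - EN deg conf; move: conf; rewrite /top2; lia.
  have neq' : ~~ [&& a' == a, d' == d, b' == b & c' == c].
    by clear - neq; lia.
  case: (top2_compare conf Hz Np neq') => [/orP[]|/orP[]|/orP[]|] H;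
    move: conf => /and4P[/eqP E1 le1 le2 /eqP E2].
  + by clear - H E1 le1 le2 E2; raise 2 (a.-1) (b.+1) (c) (d.-1).
  + by clear - H E1 le1 le2 E2; raise 3 (a.-1) (b) (c.+1) (d.-1).
  + by clear - H E1 le1 le2 E2; raise 3 (a.-1) (b) (c.+1) (d).
  + by clear - H E1 le1 le2 E2; raise 2 (a.-1) (b.+1) (c) (d).
  + by exists a', b', c', d'; split=> //; apply/or4P; constructor 2; clear - H E1; lia.
  + by exists a', b', c', d'; split=> //; apply/or4P; constructor 3; clear - H E1; lia.
  have sE : a' + b' + c' + d' = a + b + c + d by clear - H E1 le1 le2 E2 EN Nz Np; lia.
  have my : minn (minn a b) (minn c d) = b by clear - H E1; lia.
  have mz : minn (minn a' b') (minn c' d') <= b by clear - H E1 sE; lia.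
  have := precedes_spread_tie pr sE my mz; rewrite /lex4 => tie.
  exists (a.-1), (b.+1), (c), (d); split; first by rewrite /U24_sym; clear - H E1 E2; lia.
    by apply: lex_precedes_spread; rewrite /lex4 ?my; clear - H E1; lia.
  by apply/or4P; constructor 2; clear - H E1; lia.
- have Hz : [&& b' <= N, c' <= N, a' <= N, d' <= N & b' + c' + a' + d' == k + N].
    by clear - Nz EN; lia.
  have Np : N <= b by clear - EN deg conf; move: conf; rewrite /top2; lia.
  have neq' : ~~ [&& b' == b, c' == c, a' == a & d' == d].
    by clear - neq; lia.
  case: (top2_compare conf Hz Np neq') => [/orP[]|/orP[]|/orP[]|] H;
    move: conf => /and4P[/eqP E1 le1 le2 /eqP E2].
  + by clear - H E1 le1 le2 E2; raise 1 (a.+1) (b.-1) (c.-1) (d).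
  + by clear - H E1 le1 le2 E2; raise 4 (a) (b.-1) (c.-1) (d.+1).
  + by clear - H E1 le1 le2 E2; raise 4 (a) (b.-1) (c) (d.+1).
  + by clear - H E1 le1 le2 E2; raise 1 (a.+1) (b.-1) (c) (d).
  + by exists a', b', c', d'; split=> //; apply/or4P; constructor 1; clear - H E1; lia.
  + by exists a', b', c', d'; split=> //; apply/or4P; constructor 4; clear - H E1; lia.
  have sE : a' + b' + c' + d' = a + b + c + d by clear - H E1 le1 le2 E2 EN Nz Np; lia.
  have my : minn (minn a b) (minn c d) = a by clear - H E1; lia.
  have mz : minn (minn a' b') (minn c' d') <= a by clear - H E1 sE; lia.
  have := precedes_spread_tie pr sE my mz; rewrite /lex4 => tie.
  (* Here the first coordinate of y is p - 1 and that of z is p, so z cannot precede y in a tie. *)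
  by clear - H E1 sE tie; lia.
- have Hz : [&& b' <= N, d' <= N, a' <= N, c' <= N & b' + d' + a' + c' == k + N].
    by clear - Nz EN; lia.
  have Np : N <= b by clear - EN deg conf; move: conf; rewrite /top2; lia.
  have neq' : ~~ [&& b' == b, d' == d, a' == a & c' == c].
    by clear - neq; lia.
  case: (top2_compare conf Hz Np neq') => [/orP[]|/orP[]|/orP[]|] H;
    move: conf => /and4P[/eqP E1 le1 le2 /eqP E2].
  + by clear - H E1 le1 le2 E2; raise 1 (a.+1) (b.-1) (c) (d.-1).
  + by clear - H E1 le1 le2 E2; raise 3 (a) (b.-1) (c.+1) (d.-1).
  + by clear - H E1 le1 le2 E2; raise 3 (a) (b.-1) (c.+1) (d).
  + by clear - H E1 le1 le2 E2; raise 1 (a.+1) (b.-1) (c) (d).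
  + by exists a', b', c', d'; split=> //; apply/or4P; constructor 1; clear - H E1; lia.
  + by exists a', b', c', d'; split=> //; apply/or4P; constructor 3; clear - H E1; lia.
  have sE : a' + b' + c' + d' = a + b + c + d by clear - H E1 le1 le2 E2 EN Nz Np; lia.
  have my : minn (minn a b) (minn c d) = a by clear - H E1; lia.
  have mz : minn (minn a' b') (minn c' d') <= a by clear - H E1 sE; lia.
  have := precedes_spread_tie pr sE my mz; rewrite /lex4 => tie.
  by clear - H E1 sE tie; lia.
- have Hz : [&& c' <= N, d' <= N, a' <= N, b' <= N & c' + d' + a' + b' == k + N].
    by clear - Nz EN; lia.
  have Np : N <= c by clear - EN deg conf; move: conf; rewrite /top2; lia.
  have neq' : ~~ [&& c' == c, d' == d, a' == a & b' == b].
    by clear - neq; lia.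
  case: (top2_compare conf Hz Np neq') => [/orP[]|/orP[]|/orP[]|] H;
    move: conf => /and4P[/eqP E1 le1 le2 /eqP E2].
  + by clear - H E1 le1 le2 E2; raise 1 (a.+1) (b) (c.-1) (d.-1).
  + by clear - H E1 le1 le2 E2; raise 2 (a) (b.+1) (c.-1) (d.-1).
  + by clear - H E1 le1 le2 E2; raise 2 (a) (b.+1) (c.-1) (d).
  + by clear - H E1 le1 le2 E2; raise 1 (a.+1) (b) (c.-1) (d).
  + by exists a', b', c', d'; split=> //; apply/or4P; constructor 1; clear - H E1; lia.
  + by exists a', b', c', d'; split=> //; apply/or4P; constructor 2; clear - H E1; lia.
  have sE : a' + b' + c' + d' = a + b + c + d by clear - H E1 le1 le2 E2 EN Nz Np; lia.
  have my : minn (minn a b) (minn c d) = a by clear - H E1; lia.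
  have mz : minn (minn a' b') (minn c' d') <= a by clear - H E1 sE; lia.
  have := precedes_spread_tie pr sE my mz; rewrite /lex4 => tie.
  by clear - H E1 sE tie; lia.
Qed.

Lemma U24_reg_model : reg_model (bases4 U24_bases).
Proof.
apply: (@reg_model4 _ 2 U24_pow U24_sym spread).
- by rewrite /U24_pow /U24_sym; lia.
- exact: U24_powS.
- exact: U24_symE.
- exact: U24_pow_exchange.
- exact: U24_sym_exchange.
- by move=> k a b c d /U24_pow_min; lia.
- move=> k a b c d /U24_sym_min; rewrite /top2.
  by move=> /orP[|/orP[|/orP[|/orP[|/orP[|]]]]] H; clear - H; lia.
move=> k; rewrite /= !mul1n !mul0n /min4 /U24_pow /U24_sym !andbT.
by do !(apply/andP; split); lia.
Qed.

End UniformModels.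

(** * Matroids on four elements *)

Section Classification.
Local Open Scope nat_scope.

Definition tuples01 (l : nat) : seq (seq nat) :=
  iter l (fun s => [seq b :: q | b <- [:: 0; 1], q <- s]) [:: [::]].

Definition rank_sets d := [seq q <- tuples01 4 | sumn q == d].

Fixpoint sublists (T : Type) (s : seq T) : seq (seq T) :=
  if s is x :: s' then
    let r := sublists s' in r ++ [seq x :: t | t <- r]
  else [:: [::]].

Lemma filter_sublists (T : eqType) (a : pred T) s : filter a s \in sublists s.
Proof.
elim: s => //= x s IHs; rewrite mem_cat; case: (a x); rewrite ?IHs //.
by apply/orP; right; apply/mapP; exists (filter a s).
Qed.

Definition basis_exchange (bs : seq (seq nat)) : bool :=
  all (fun q => all (fun q' => all (fun i => (nth 0 q' i < nth 0 q i) ==>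
    has (fun j => (nth 0 q j < nth 0 q' j) &&
      (set_nth 0 (set_nth 0 q i 0) j 1 \in bs)) (iota 0 4)) (iota 0 4)) bs) bs.

(* The i-th entry of cs is the class of element i, the value 4 marking loops. *)
Definition class_quad (cs : seq nat) (q : seq nat) : nat * nat * nat * nat :=
  let f t := sumn [seq if c.1 == t then c.2 else 0 | c <- zip cs q] in
  (f 0, f 1, f 2, f 3).

Definition no_loops (cs : seq nat) (q : seq nat) : bool :=
  all (fun c => (c.1 == 4) ==> (c.2 == 0)) (zip cs q).

(** The singletons are U_(m,m) for m from 0 to 4, with m = 0 giving the unit ideal. *)
Definition models : seq (seq (nat * nat * nat * nat)) :=
  [:: [:: (0, 0, 0, 0)]; [:: (1, 0, 0, 0)]; [:: (1, 1, 0, 0)]; [:: (1, 1, 1, 0)];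
      [:: (1, 1, 1, 1)]; U23_bases false; U23_bases true; U24_bases; U34_bases].

Definition class_maps : seq (seq nat) :=
  iter 4 (fun s => [seq c :: cs | c <- iota 0 5, cs <- s]) [:: [::]].

Definition is_model (bs : seq (seq nat)) (cs : seq nat)
    (Bs : seq (nat * nat * nat * nat)) : bool :=
  all (fun q => (q \in bs) == no_loops cs q && (class_quad cs q \in Bs)) (tuples01 4).

(* The two inner tests are implied by [is_model]; they speed up the search. *)
Definition has_model (bs : seq (seq nat)) : bool :=
  has (fun cs => if all (no_loops cs) bs then
    has (fun Bs => if all (fun q => class_quad cs q \in Bs) bs
      then is_model bs cs Bs else false) models else false) class_maps.

(** A finite check: at most 2^6 families of bases in each rank, 5^4 class maps and nine models. *)
Lemma matroid4_classification :
  all (fun d => all (fun bs => (bs != [::]) && basis_exchange bs ==> has_model bs)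
    (sublists (rank_sets d))) (iota 0 5).
Proof. by vm_compute. Qed.

End Classification.

Lemma models_reg_model Bs : Bs \in models -> reg_model (bases4 Bs).
Proof.
have box a b c d : (a <= 1)%N -> (b <= 1)%N -> (c <= 1)%N -> (d <= 1)%N ->
    reg_model (bases4 [:: (a, b, c, d)]).
  move=> a1 b1 c1 d1; apply: (@box_reg_model _ _ (mk4 a b c d)).
    move=> y; split=> [[q]|->]; first by rewrite inE => /eqP ->.
    by exists (a, b, c, d); rewrite ?inE.
  by apply: I4_ind; rewrite mk4E.
rewrite !inE; do 5!(case/orP=> [/eqP ->|]; first exact: box).
do 2!(case/orP=> [/eqP ->|]; first exact: U23_reg_model).
by case/orP=> /eqP ->; [apply: U24_reg_model|apply: U34_reg_model].
Qed.

Lemma mem_tuples01 l (q : seq nat) :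
  (q \in tuples01 l) = (size q == l) && all (fun b => (b <= 1)%N) q.
Proof.
elim: l q => [|l IHl] q; first by rewrite inE; case: q.
case: q => [|b q]; first by rewrite /tuples01 iterS; apply/negbTE/negP => /allpairsP[[? ?] []].
rewrite /tuples01 iterS -/(tuples01 l) [size _]/= [all _ _]/= eqSS; apply/allpairsP/idP.
  move=> [[b' q'] /= [b'01 q'l [-> ->]]]; move: q'l; rewrite IHl => /andP[-> ->].
  by move: b'01; rewrite !inE => /orP[] /eqP ->.
move=> /and3P[sq b1 q1]; exists (b, q); rewrite IHl sq q1; split=> //.
by case: b b1 => [|[]].
Qed.

Section MonomialGenerators.
Variables (K : fieldType) (n : nat) (I : {mpoly K[n]} -> Prop).

Lemma monomial_ideal_mingens : monomial_ideal I ->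
  forall f, I f <-> supp_in (above (mingens I)) f.
Proof.
case=> M IM.
(* Excluded middle makes the exponent set boolean, so that the existence of minimal elements
   applies. *)
pose J : pred 'X_{1..n} := fun m =>
  if excluded_middle_informative (above M m) then true else false.
have JP m : J m <-> above M m by rewrite /J; case: excluded_middle_informative.
have upJ : upclosed J by move=> u v uv /JP Ju; apply/JP; apply: above_up uv Ju.
have IJ f : I f <-> supp_in J f.
  by rewrite IM monomial_gen_supp; split; apply: supp_inW => m /JP.
move=> f; rewrite IJ; split; apply: supp_inW => m.
  move=> /exists_min_elt[v minv vm]; exists v => //.
  exact/(supp_in_mingens upJ IJ).
by move=> [v /(supp_in_mingens upJ IJ)/andP[Jv _] vm]; apply: upJ Jv.
Qed.

End MonomialGenerators.

(** * Transfer of the classification to the variables of the ideal *)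

Section Coordinates.
Variables (n : nat) (V : {set 'I_n}).
Hypothesis V4 : (#|V| <= 4)%N.
Implicit Types (u v : 'X_{1..n}) (q cs : seq nat).

Definition pos (i : 'I_n) : nat := index i (enum V).
Definition coord u j : nat := (\sum_(i in V | pos i == j) u i)%N.
Definition coords u : seq nat := [seq coord u j | j <- iota 0 4].
Definition of_coords q : 'X_{1..n} :=
  [multinom if i \in V then nth 0%N q (pos i) else 0%N | i < n].

Lemma pos_lt i : i \in V -> (pos i < 4)%N.
Proof.
by move=> iV; apply: leq_trans V4; rewrite cardE index_mem mem_enum.
Qed.

Lemma pos_inj : {in V &, injective pos}.
Proof.
move=> i j iV jV E; rewrite -(nth_index i (_ : i \in enum V)) ?mem_enum //.
by rewrite -/(pos i) E nth_index ?mem_enum.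
Qed.

Lemma coord_pos u i : i \in V -> coord u (pos i) = u i.
Proof.
move=> iV; rewrite /coord (big_pred1 i) // => j.
case jV: (j \in V); last by apply/esym/eqP => ji; rewrite ji iV in jV.
by apply/eqP/eqP => [/(pos_inj jV iV)|->].
Qed.

Lemma coord_gt0 u j : (0 < coord u j)%N -> exists2 i, i \in V & pos i = j.
Proof.
rewrite lt0n sum_nat_eq0 negb_forall_in => /exists_inP[i /andP[iV /eqP ij] _].
by exists i.
Qed.

Lemma nth_coords u j : (j < 4)%N -> nth 0%N (coords u) j = coord u j.
Proof. by move=> j4; rewrite (nth_map 0%N) ?size_iota // nth_iota. Qed.

Lemma coordsK u : (forall i, (0 < u i)%N -> i \in V) -> of_coords (coords u) = u.
Proof.
move=> uV; apply/mnmP=> i; rewrite mnmE; case: ifP => iV.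
  by rewrite nth_coords ?pos_lt // coord_pos.
by case: posnP (uV i) => // _ /(_ isT); rewrite iV.
Qed.

Lemma coords_tuples01 u : (forall i, (u i <= 1)%N) -> coords u \in tuples01 4.
Proof.
move=> u1; rewrite mem_tuples01 size_map size_iota eqxx andTb.
apply/allP=> b /mapP[j _ ->]; case: (posnP (coord u j)) => [-> //|].
by move=> /coord_gt0[i iV <-]; rewrite coord_pos.
Qed.

Lemma sum_coord (F : nat -> bool) u :
  (\sum_(i in V | F (pos i)) u i = \sum_(j < 4 | F j) coord u j)%N.
Proof.
rewrite /coord (exchange_big_dep (fun i => (i \in V) && F (pos i))) /=.
  apply: eq_bigr => i /andP[iV Fi].
  rewrite (big_pred1 (Ordinal (pos_lt iV))) // => j; rewrite iV /=.
  rewrite -val_eqE /= [RHS]eq_sym andb_idl // => /eqP <- //.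
by move=> j i Fj /andP[-> /eqP ->].
Qed.

Lemma sumn_coords u : (forall i, (0 < u i)%N -> i \in V) ->
  sumn (coords u) = mdeg u.
Proof.
move=> uV; rewrite mdegE [RHS](bigID (mem V)) [X in _ = (_ + X)%N]big1 ?addn0 /=.
  have := sum_coord xpredT u; under eq_bigl do rewrite andbT; move=> ->.
  by rewrite !big_ord_recr big_ord0 /= add0n !addnA addn0.
by move=> i iV; case: posnP (uV i) => // _ /(_ isT); rewrite (negbTE iV).
Qed.

Section Classes.
Variable cs : seq nat.
Hypothesis cs4 : size cs = 4.

(** The value 4 is out of range for [insub], so it yields [None]: a loop, like every variable
    outside [V]. *)
Definition class_of (i : 'I_n) : option 'I_4 :=
  if i \in V then insub (nth 4 cs (pos i)) else None.

Lemma class_of_eq i t : (class_of i == Some t) =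
  (i \in V) && (nth 4 cs (pos i) == t).
Proof.
rewrite /class_of; case: (i \in V) => //=; case: insubP => [s _ <-|].
  by rewrite (inj_eq (@Some_inj _)) -val_eqE.
by move=> ge; apply/esym/negbTE; apply: contra ge => /eqP ->; apply: ltn_ord.
Qed.

Lemma class_quadE u :
  let y := class_sum class_of u in
  class_quad cs (coords u) = (y o0, y o1, y o2, y o3).
Proof.
have E t : class_sum class_of u t =
    sumn [seq if c.1 == t :> nat then c.2 else 0%N | c <- zip cs (coords u)].
  rewrite mnmE; under eq_bigl do rewrite class_of_eq.
  rewrite (sum_coord (fun j => nth 4 cs j == t)).
  case: cs cs4 => [|c0 [|c1 [|c2 [|c3 []]]]] //= _.
  by rewrite big_mkcond !big_ord_recr big_ord0 /= add0n !addnA addn0.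
by rewrite /= !E.
Qed.

Lemma no_loopsP u : (forall i, i \in V -> (nth 4 cs (pos i) <= 4)%N) ->
  reflect (loopfree class_of u)
    (no_loops cs (coords u) && [forall i, (i \notin V) ==> (u i == 0%N)]).
Proof.
move=> cs_le; have E : no_loops cs (coords u) <->
    forall j, (j < 4)%N -> nth 4 cs j = 4 -> coord u j = 0%N.
  rewrite /no_loops; case: cs cs4 => [|c0 [|c1 [|c2 [|c3 []]]]] //= _; split.
    move=> /and5P[H0 H1 H2 H3 _] [|[|[|[|//]]]] _ /= E;
      [move: H0|move: H1|move: H2|move: H3]; by rewrite E => /eqP.
  move=> H; rewrite andbT; apply/and4P; split; apply/implyP => /eqP E; apply/eqP;
    [exact: (H 0%N)|exact: (H 1%N)|exact: (H 2%N)|exact: (H 3%N)].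
apply: (iffP andP) => [[/E nl /forallP H] i iN | lu].
  case iV: (i \in V); last by have := H i; rewrite iV => /eqP.
  rewrite -coord_pos //; apply: nl; first exact: pos_lt.
  move: iN; rewrite /class_of iV; case: insubP => // ge _.
  by apply/eqP; rewrite eqn_leq cs_le // leqNgt.
split; last first.
  by apply/forallP=> i; apply/implyP=> iV; rewrite lu // /class_of (negbTE iV).
apply/E => j j4 cj; apply/eqP; rewrite -leqn0 leqNgt; apply/negP => uj.
have [i iV ij] := coord_gt0 uj; move: uj; rewrite -ij coord_pos // lu //.
by rewrite /class_of iV ij cj insubF.
Qed.

End Classes.

Variable G : 'X_{1..n} -> Prop.
Hypothesis GV : forall u i, G u -> (0 < u i)%N -> i \in V.
Hypothesis Gsqfree : forall u i, G u -> (u i <= 1)%N.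
Hypothesis Gnonempty : exists u, G u.
Variable d : nat.
Hypothesis Gdeg : forall u, G u -> mdeg u = d.
Hypothesis Gexch : forall u v, G u -> G v -> forall i, (v i < u i)%N ->
  exists2 j, (u j < v j)%N & G (u - U_(i) + U_(j))%MM.

Lemma classification : exists cl Bs, Bs \in models /\
  forall u, G u <-> lift_bases cl (bases4 Bs) u.
Proof.
pose isG q := if excluded_middle_informative
  (G (of_coords q) /\ coords (of_coords q) = q) then true else false.
have isGP q : isG q <-> G (of_coords q) /\ coords (of_coords q) = q.
  by rewrite /isG; case: excluded_middle_informative.
pose bs := filter isG (rank_sets d).
have coordsG u : G u -> coords u \in bs.
  move=> Gu; rewrite mem_filter mem_filter sumn_coords ?Gdeg ?eqxx //=; last first.
    by move=> i; apply: GV.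
  rewrite coords_tuples01 ?andbT //=; last by move=> i; apply: Gsqfree.
  by apply/isGP; rewrite coordsK // => i; apply: GV.
have bsP q : q \in bs -> G (of_coords q) /\ coords (of_coords q) = q.
  by rewrite mem_filter => /andP[/isGP].
have d4 : (d < 5)%N.
  have [u Gu] := Gnonempty; rewrite -(Gdeg Gu) -sumn_coords; last first.
    by move=> i; apply: GV.
  have : coords u \in tuples01 4 by apply: coords_tuples01 => i; apply: Gsqfree.
  rewrite mem_tuples01; case: (coords u) => [|a [|b [|c [|e []]]]] //= .
  by move=> /and5P[]; lia.
have bs0 : bs != [::].
  by have [u /coordsG] := Gnonempty; case: (bs).
have exch : basis_exchange bs.
  apply/allP=> q qb; apply/allP=> q' q'b; apply/allP=> i.
  rewrite mem_iota add0n => i4; apply/implyP => qi.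
  have [Gq qE] := bsP q qb; have [Gq' qE'] := bsP q' q'b.
  set u := of_coords q in Gq qE; set v := of_coords q' in Gq' qE'.
  rewrite -qE -qE' !nth_coords // in qi.
  have [s sV si] := coord_gt0 (leq_ltn_trans (leq0n _) qi).
  rewrite -si !coord_pos // in qi.
  have [r ur Gw] := Gexch Gq Gq' qi.
  have rV : r \in V by apply: (GV Gq'); apply: leq_ltn_trans ur.
  have sr : s != r by apply: contraTneq ur => <-; rewrite -leqNgt ltnW.
  apply/hasP; exists (pos r); first by rewrite mem_iota pos_lt.
  rewrite -{1}qE -{1}qE' !nth_coords ?pos_lt // !coord_pos // ur /=.
  (* Squarefreeness makes both assignments exact: the entry at [s] drops from 1 to 0 and that at [r]
     rises from 0 to 1. *)
  suff -> : set_nth 0%N (set_nth 0%N q i 0%N) (pos r) 1%N =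
    coords (u - U_(s) + U_(r))%MM by apply: coordsG.
  have sq : size q = 4 by rewrite -qE size_map size_iota.
  apply: (@eq_from_nth _ 0%N).
    rewrite !size_set_nth size_map size_iota sq.
    by have := pos_lt rV; lia.
  move=> j; rewrite !size_set_nth sq => jlt.
  have j4 : (j < 4)%N by have := pos_lt rV; lia.
  rewrite nth_set_nth /= nth_set_nth /= nth_coords //.
  case: (eqVneq j (pos r)) => [->|jr].
    rewrite coord_pos // mnmDE mnmBE !mnm1E eqxx (negbTE sr) subn0.
    by have := Gsqfree r Gq'; lia.
  case: (eqVneq j i) => [->|ji].
    rewrite -si coord_pos // mnmDE mnmBE !mnm1E eqxx eq_sym (negbTE sr).
    by have := Gsqfree s Gq; lia.
  rewrite -qE nth_coords //; apply: eq_bigr => t /andP[tV /eqP tj].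
  rewrite mnmDE mnmBE !mnm1E.
  have -> : (s == t) = false by apply: contraNF ji => /eqP E; rewrite -tj -E si.
  have -> : (r == t) = false by apply: contraNF jr => /eqP E; rewrite -tj -E.
  by rewrite subn0 addn0.
have /allP/(_ d) := matroid4_classification; rewrite mem_iota => /(_ d4)/allP.
move=> /(_ bs (filter_sublists _ _)); rewrite bs0 exch /=.
move=> /hasP[cs cs_in]; case: ifP => // _ /hasP[Bs Bs_in].
case: ifP => // _ /allP model.
have [cs4 cs_le] : size cs = 4 /\ forall j, (nth 4 cs j <= 4)%N.
  have : all (fun cs => (size cs == 4) && all (fun c => (c <= 4)%N) cs) class_maps.
    by vm_compute.
  move=> /allP/(_ _ cs_in)/andP[/eqP sz /(all_nthP 4) le4]; split=> // j.
  by case: (ltnP j (size cs)) => [/le4|/(nth_default 4) ->].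
exists (class_of cs), Bs; split=> // u.
have csumE : bases4 Bs (class_sum (class_of cs) u) <-> class_quad cs (coords u) \in Bs.
  rewrite class_quadE //; set y := class_sum _ u.
  split=> [[[[[a b] c] e] qB ->]|yB]; first by rewrite !mk4E.
  by exists (y o0, y o1, y o2, y o3); rewrite ?mk4_eta.
have nlP := @no_loopsP cs cs4 u (fun i _ => cs_le (pos i)).
split=> [Gu | [lu Bu]].
  have cu := coordsG u Gu.
  have cu01 : coords u \in tuples01 4 by apply: coords_tuples01 => i; apply: Gsqfree.
  have := model _ cu01; rewrite cu => /eqP/esym/andP[nl cB].
  split; last exact/csumE.
  apply/nlP; rewrite nl; apply/forallP=> i; apply/implyP => iV.
  by rewrite -leqn0 leqNgt; apply: contra iV; apply: GV.
have uV i : (0 < u i)%N -> i \in V.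
  move=> ui; case iV: (i \in V) => //.
  by move: ui; rewrite lu // /class_of iV.
(* Bases of the models have entries at most one, so every lift is squarefree and its coordinates are
   among the tuples tested by [is_model]. *)
have Bs1 : forall a b c e, (a, b, c, e) \in Bs -> [&& a <= 1, b <= 1, c <= 1 & e <= 1]%N.
  have /allP/(_ _ Bs_in)/allP H : all (all (fun q : nat * nat * nat * nat =>
    let: (a, b, c, e) := q in [&& a <= 1, b <= 1, c <= 1 & e <= 1]%N)) models by [].
  by move=> a b c e /H.
have u1 i : (u i <= 1)%N.
  case: (posnP (u i)) => [-> //|ui].
  case ci: (class_of cs i) => [t|]; last by rewrite lu.
  have le : (u i <= class_sum (class_of cs) u t)%N.
    by rewrite mnmE (bigD1 i) ?ci //= leq_addr.
  apply: leq_trans le _; case: Bu => -[[[a b] c] e] /Bs1/and4P[a1 b1 c1 e1] ->.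
  by move: t {ci}; apply: I4_ind; rewrite mk4E.
have := model _ (coords_tuples01 u1); move/csumE: Bu => ->.
have /nlP/andP[-> _] := lu.
by rewrite eqb_id => /bsP[]; rewrite coordsK.
Qed.

End Coordinates.

Theorem proposition6p6 (K : fieldType) (n : nat) (I : {mpoly K[n]} -> Prop)
    (hI : matroidal I) (h4 : at_most_variables 4 I)
    (k : nat) (hk : (1 <= k)%N) :
  (exists r : int, has_reg (symb_pow I k) r /\ has_reg (ideal_pow I k) r) /\
  linear_quotients (symb_pow I k).
Proof.
have [[monI [f If f0] [d Gdeg] exch] sqfree] := hI; have [V V4 GV] := h4.
have IG := monomial_ideal_mingens monI.
have Gnonempty : exists u, mingens I u.
  by have [u Gu _] := (IG f).1 If _ (mlead_supp f0); exists u.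
have [cl [Bs [Bs_in GB]]] := @classification n V V4 (mingens I)
  (fun u i Gu => GV u Gu i) (fun u i Gu => sqfree u Gu i) Gnonempty d Gdeg exch.
exact: (reg_model_proposition IG (fun b i Gb => sqfree b Gb i) Gnonempty GB
  (models_reg_model Bs_in)).
Qed.
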